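(* Let $(x_n,y_n)$ be a sequence of pairwise distinct pairs of natural numbers such that $x_n\le y_n$ for all $n$, the sequence $(x_n)$ is lower semicomputable, the sequence $(y_n)$ is upper semicomputable, and $\sum_n 2^{x_n-y_n}=+\infty$. Then: (i) there exists $n$ such that $B(x_n)>\mathrm{BP}'(y_n)$; (ii) there exists $n$ such that $\mathrm{BP}'(x_n)>\mathrm{BP}(y_n)$.
   Context: Fix an optimal (plain) decompressor $D$; $\mathrm{KS}(N)$ denotes the plain Kolmogorov complexity of $N$, i.e. the minimal length of a string $p$ with $D(p)=N$. Fix an optimal prefix-free decompressor; $\mathrm{KP}(N)$ denotes the resulting prefix Kolmogorov complexity. Fix a discrete a priori probability $\mathbf m$: a lower semicomputable sequence of non-negative reals $\mathbf m(k)$ with $\sum_k \mathbf m(k)$ convergent that is maximal up to a multiplicative constant among all such sequences (so $\mathbf m(k)=2^{-\mathrm{KP}(k)+O(1)}$). Define $B(n)=\max\{N : \mathrm{KS}(N)\le n\}$, $\mathrm{BP}(n)=\max\{N:\mathrm{KP}(N)\le n\}$, and $\mathrm{BP}'(n)$ = the minimal $N$ such that $\sum_{k>N}\mathbf m(k)<2^{-n}$. A sequence $(y_n)$ of natural numbers is lower (resp. upper) semicomputable if $y_n=\lim_k y(n,k)$ for a total computable function $y(\cdot,\cdot)$ non-decreasing (resp. non-increasing) in $k$. *)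

(* Defs.v *)
From HB Require Import structures.
From mathcomp Require Import all_boot all_order all_algebra.
From mathcomp Require Import all_classical all_reals all_analysis.

Set Implicit Arguments.
Unset Strict Implicit.
Unset Printing Implicit Defensive.

Import Order.TTheory GRing.Theory Num.Theory.
Import numFieldNormedType.Exports.

Local Open Scope classical_set_scope.
Local Open Scope ring_scope.

Inductive recf : nat -> Type :=
| RZero n : recf n
| RSucc : recf 1
| RProj n : 'I_n -> recf n
| RComp m n : recf m -> ('I_m -> recf n) -> recf n
| RPrec n : recf n -> recf n.+2 -> recf n.+1
| RMu n : recf n.+1 -> recf n.

(* [eval f v z]: the partial function coded by [f] converges on [v] with
   value [z].  For [RPrec f g] the recursion is on the first argument:
   h(0, w) = f(w) and h(i+1, w) = g(i, h(i, w), w).  For [RMu f] the value is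
   the least z with f(z, v) = 0, all earlier values being defined. *)
Fixpoint eval (n : nat) (f : recf n) : n.-tuple nat -> nat -> Prop :=
  match f in recf n return n.-tuple nat -> nat -> Prop with
  | RZero _ => fun _ z => z = 0%N
  | RSucc => fun v z => z = (thead v).+1
  | RProj _ i => fun v z => z = tnth v i
  | RComp m _ f g => fun v z =>
      exists w : m.-tuple nat, (forall i, eval (g i) v (tnth w i)) /\ eval f w z
  | RPrec n f g => fun v =>
      let w : n.-tuple nat := [tuple of behead v] in
      (fix prec (k : nat) : nat -> Prop :=
         match k with
         | 0 => eval f w
         | i.+1 => fun z =>
             exists u, prec i u /\ eval g [tuple of i :: u :: w] z
         end) (thead v)
  | RMu _ f => fun v z =>
      eval f [tuple of z :: v] 0%N /\
      (forall i, (i < z)%N -> exists u, eval f [tuple of i :: v] u.+1)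
  end.

Definition computable2 (f : nat -> nat -> nat) : Prop :=
  exists c : recf 2, forall i j, eval c [tuple i; j] (f i j).

(* The bijection between binary strings and natural numbers given by bijective
   base-2 notation (least significant digit first). *)
Fixpoint string_code (p : seq bool) : nat :=
  if p is b :: q then ((string_code q).*2 + b).+1 else 0%N.

(* Decompressors are partial computable functions from strings to naturals;
   [None] stands for divergence. *)
Definition decompressor (D : seq bool -> option nat) : Prop :=
  exists c : recf 1, forall p N,
    D p = Some N <-> eval c [tuple string_code p] N.

Definition is_min (A : set nat) (k : nat) : Prop :=
  A k /\ forall l, A l -> (k <= l)%N.

Definition is_max (A : set nat) (k : nat) : Prop :=
  A k /\ forall l, A l -> (l <= k)%N.

(* [is_complexity D N k]: the complexity of [N] with respect to [D] is the
   natural number [k].  There is no such [k] when [N] has no description. *)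
Definition is_complexity (D : seq bool -> option nat) (N k : nat) : Prop :=
  is_min [set size p | p in [set p | D p = Some N]] k.

Definition complexity_le (D : seq bool -> option nat) (N n : nat) : Prop :=
  exists k, is_complexity D N k /\ (k <= n)%N.

(* K_D <= K_E + O(1), complexities being infinite when there is no
   description. *)
Definition not_worse (D E : seq bool -> option nat) : Prop :=
  exists c : nat, forall N k, is_complexity E N k -> complexity_le D N (k + c).

Definition optimal_decompressor (D : seq bool -> option nat) : Prop :=
  decompressor D /\ forall E, decompressor E -> not_worse D E.

Definition prefix_free (D : seq bool -> option nat) : Prop :=
  forall p q, D p <> None -> D q <> None -> prefix p q -> p = q.

Definition prefix_decompressor (D : seq bool -> option nat) : Prop :=
  decompressor D /\ prefix_free D.

Definition optimal_prefix_decompressor (D : seq bool -> option nat) : Prop :=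
  prefix_decompressor D /\ forall E, prefix_decompressor E -> not_worse D E.

(* A computable array of rationals is presented as (a - b) / (c + 1) with
   a, b, c total computable. *)
Definition computable_ratio (R : realType) (q : nat -> nat -> R) : Prop :=
  exists a b c : nat -> nat -> nat,
    [/\ computable2 a, computable2 b, computable2 c &
      forall k i, q k i = ((a k i)%:R - (b k i)%:R) / (c k i).+1%:R].

Definition lower_semicomputable_real (R : realType) (m : nat -> R) : Prop :=
  exists q : nat -> nat -> R,
    [/\ computable_ratio q,
        forall k i j, (i <= j)%N -> q k i <= q k j &
        forall k, q k i @[i --> \oo] --> m k].

Definition summable_lsc (R : realType) (m : nat -> R) : Prop :=
  [/\ lower_semicomputable_real m, forall k, 0 <= m k & cvgn (series m)].

Definition apriori_probability (R : realType) (m : nat -> R) : Prop :=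
  summable_lsc m /\
  forall m' : nat -> R, summable_lsc m' ->
    exists C : R, 0 < C /\ forall k, m' k <= C * m k.

(* [is_B D n M]: M is the largest number of D-complexity at most n.  This is
   B(n) for an optimal plain D and BP(n) for an optimal prefix-free D. *)
Definition is_B (D : seq bool -> option nat) (n M : nat) : Prop :=
  is_max [set N | complexity_le D N n] M.

Definition is_BP' (R : realType) (m : nat -> R) (n M : nat) : Prop :=
  is_min [set N | (\sum_(N.+1 <= k <oo) (m k)%:E < (2 ^- n)%:E)%E] M.

Definition lower_semicomputable (x : nat -> nat) : Prop :=
  exists f : nat -> nat -> nat,
    [/\ computable2 f, forall n i j, (i <= j)%N -> (f n i <= f n j)%N &
        forall n, f n k @[k --> \oo] --> x n].

Definition upper_semicomputable (y : nat -> nat) : Prop :=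
  exists f : nat -> nat -> nat,
    [/\ computable2 f, forall n i j, (i <= j)%N -> (f n j <= f n i)%N &
        forall n, f n k @[k --> \oo] --> y n].

(* Main.v *)
(* Both parts play one game for every constant [c], with approximations from
   below to [x] and from above to [y]; every demand made for approximate values
   is implied by the one for their limits.  As the sum diverges, one can compute
   a stage [horizon c] at which the distinct approximate pairs with [x > 2 * c]
   have a large sum of [2 ^ (x - y)].

   (i) Strings of length [x - c] taken from the share of game [c] are issued one
   by one as descriptions of larger and larger numbers [v].  If
   [B (x n) <= BP' (y n)] held for all [n] and [c] is large, then [m] would have
   mass at least [2 ^ - y] from [v] on; the game waits until this mass shows up
   and continues beyond it.  Each pair thus costs [m] about
   [2 ^ (x - 2 * c) * 2 ^ - y], in total more than its sum.

   (ii) Game [c] places [2 ^ horizon c] equal weights at larger and larger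
   points, and only when for every pair [(x, y)] some program of length at most
   [y] has output a number beyond which fewer than the fraction
   [2 ^ (2 * c - x)] of the weights lie.  Since [m] dominates the weights, the
   game is never stuck if [BP' (x n) <= BP (y n)] for all [n] and [c] is large.
   Hence at least [2 ^ (x - 2 * c - 1)] programs of length at most [y] halt for
   every pair, which contradicts Kraft's inequality. *)
From mathcomp Require Import all_boot all_order all_algebra.
From mathcomp Require Import all_classical all_reals all_analysis.
From mathcomp Require Import zify ring lra.
Require Import Defs.

Set Implicit Arguments.
Unset Strict Implicit.
Unset Printing Implicit Defensive.

Import Order.TTheory GRing.Theory Num.Theory.
Import numFieldNormedType.Exports.

Local Open Scope classical_set_scope.

(** * Total computable functions *)

(* The arguments of a function of arity [n] are the entries of a list; the
   values of [F] on lists of other lengths are irrelevant. *)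
Definition computable n (F : seq nat -> nat) :=
  exists c : recf n, forall v : n.-tuple nat, eval c v (F v).

Definition computable_pred n (p : seq nat -> bool) :=
  computable n (fun v => p v).

Definition computable_seq n (d : seq nat -> seq nat) :=
  forall k, computable n (fun v => nth 0 (d v) k).

Lemma eq_computable n (F G : seq nat -> nat) :
  (forall v : n.-tuple nat, F v = G v) -> computable n F -> computable n G.
Proof. by move=> FG [c cF]; exists c => v; rewrite -FG. Qed.

Lemma computable0 n : computable n (fun=> 0).
Proof. by exists (RZero n). Qed.

Lemma computable_nth n k : computable n (fun v => nth 0 v k).
Proof.
case: (ltnP k n) => kn.
  by exists (RProj (Ordinal kn)) => v /=; rewrite (tnth_nth 0).
by apply: eq_computable (computable0 n) => v; rewrite nth_default ?size_tuple.
Qed.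

Lemma computable_id n : computable_seq n id.
Proof. exact: computable_nth. Qed.

Lemma computable_nil n : computable_seq n (fun=> [::]).
Proof.
by move=> k; apply: eq_computable (computable0 n) => v; rewrite nth_nil.
Qed.

Lemma computable_cons n F d : computable n F -> computable_seq n d ->
  computable_seq n (fun v => F v :: d v).
Proof. by move=> F_comp d_comp [|k]; [exact: F_comp|exact: d_comp]. Qed.

Lemma computable_head n d : computable n (fun v => nth 0 (d v) 0) ->
  computable n (fun v => head 0 (d v)).
Proof. by apply: eq_computable => v; rewrite nth0. Qed.

Lemma computable_nth_behead n d k : computable n (fun v => nth 0 (d v) k.+1) ->
  computable n (fun v => nth 0 (behead (d v)) k).
Proof. by apply: eq_computable => v; rewrite nth_behead. Qed.

Lemma computable_behead n d : computable_seq n d ->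
  computable_seq n (fun v => behead (d v)).
Proof. by move=> d_comp k; exact: computable_nth_behead. Qed.

Lemma computable_comp m n G d : computable m G -> computable_seq n d ->
  (forall v : n.-tuple nat, size (d v) = m) -> computable n (fun v => G (d v)).
Proof.
move=> [c cG] d_comp sz_d.
have /choice[g g_eval] (i : 'I_m) := d_comp i.
exists (RComp c g) => v /=; exists (Tuple (introT eqP (sz_d v))).
split; last exact: cG.
by move=> i; rewrite (tnth_nth 0); exact: g_eval.
Qed.

Definition computable1 f := computable 1 (fun v => f (nth 0 v 0)).
Definition computable3 f :=
  computable 3 (fun v => f (nth 0 v 0) (nth 0 v 1) (nth 0 v 2)).
Definition computable4 f :=
  computable 4 (fun v => f (nth 0 v 0) (nth 0 v 1) (nth 0 v 2) (nth 0 v 3)).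

Lemma computable2P f :
  computable2 f <-> computable 2 (fun v => f (nth 0 v 0) (nth 0 v 1)).
Proof.
split=> -[c c_eval]; exists c; last by move=> a b; exact: (c_eval [tuple a; b]).
case/tupleP=> a v; case/tupleP: v => b v; rewrite (tuple0 v) /=.
exact: c_eval.
Qed.

Lemma computable1_comp n f A :
  computable1 f -> computable n A -> computable n (fun v => f (A v)).
Proof.
move=> f_comp A_comp.
apply: (computable_comp (d := fun v => [:: A v]) f_comp) => //.
by apply: computable_cons => //; exact: computable_nil.
Qed.

Lemma computable2_comp n f A B : computable2 f ->
  computable n A -> computable n B -> computable n (fun v => f (A v) (B v)).
Proof.
move=> /computable2P f_comp A_comp B_comp.
apply: (computable_comp (d := fun v => [:: A v; B v]) f_comp) => //.
by do 2!apply: computable_cons => //; exact: computable_nil.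
Qed.

Lemma computable3_comp n f A B C : computable3 f ->
  computable n A -> computable n B -> computable n C ->
  computable n (fun v => f (A v) (B v) (C v)).
Proof.
move=> f_comp A_comp B_comp C_comp.
apply: (computable_comp (d := fun v => [:: A v; B v; C v]) f_comp) => //.
by do 3!apply: computable_cons => //; exact: computable_nil.
Qed.

Lemma computable4_comp n f A B C D : computable4 f ->
  computable n A -> computable n B -> computable n C -> computable n D ->
  computable n (fun v => f (A v) (B v) (C v) (D v)).
Proof.
move=> f_comp A_comp B_comp C_comp D_comp.
apply: (computable_comp (d := fun v => [:: A v; B v; C v; D v]) f_comp) => //.
by do 4!apply: computable_cons => //; exact: computable_nil.
Qed.

Definition prec_graph n (f : recf n) (g : recf n.+2) (v : n.-tuple nat) :=
  fix prec (k : nat) : nat -> Prop :=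
    match k with
    | 0 => eval f v
    | i.+1 => fun z => exists u, prec i u /\ eval g [tuple of i :: u :: v] z
    end.

Lemma eval_precE n (f : recf n) (g : recf n.+2) (v : n.-tuple nat) k :
  eval (RPrec f g) [tuple of k :: v] = prec_graph f g v k.
Proof.
set w := [tuple of k :: v].
rewrite -[LHS]/(prec_graph f g [tuple of behead w] (thead w)) theadE.
by congr (prec_graph f g _ k); exact: val_inj.
Qed.

Lemma computable_prec n F G : computable n F ->
  computable n.+2 (fun w =>
    G (head 0 w) (head 0 (behead w)) (behead (behead w))) ->
  computable n.+1 (fun v =>
    iteri (head 0 v) (fun i u => G i u (behead v)) (F (behead v))).
Proof.
move=> [f f_eval] [g g_eval]; exists (RPrec f g); case/tupleP=> k v.
rewrite eval_precE; elim: k => [|k IHk] /=; first exact: f_eval.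
by exists (iteri k (fun i u => G i u v) (F v)); split=> //; exact: g_eval.
Qed.

Lemma computable_iteri n B F G : computable n B -> computable n F ->
  computable n.+2 (fun w =>
    G (head 0 w) (head 0 (behead w)) (behead (behead w))) ->
  computable n (fun v => iteri (B v) (fun i u => G i u v) (F v)).
Proof.
move=> B_comp F_comp G_comp.
have prec_comp := computable_prec F_comp G_comp.
apply: (computable_comp (d := fun v => B v :: v) prec_comp).
  exact: computable_cons B_comp (@computable_id n).
by move=> v; rewrite /= size_tuple.
Qed.

Lemma computable_weak n F : computable n F ->
  computable n.+1 (fun w => F (behead w)).
Proof.
move=> F_comp; apply: (computable_comp F_comp).
  exact/computable_behead/computable_id.
by move=> v; rewrite size_behead size_tuple.
Qed.

Lemma computable_cons_comp m n F S d :
  computable m.+1 (fun w => F (head 0 w) (behead w)) ->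
  computable n S -> computable_seq n d ->
  (forall v : n.-tuple nat, size (d v) = m) ->
  computable n (fun v => F (S v) (d v)).
Proof.
move=> F_comp S_comp d_comp sz_d.
apply: (computable_comp (d := fun v => S v :: d v) F_comp).
  exact: computable_cons.
by move=> v; rewrite /= sz_d.
Qed.

Lemma computable_weak_cons n F :
  computable n.+1 (fun w => F (head 0 w) (behead w)) ->
  computable n.+2 (fun w => F (head 0 w) (behead (behead w))).
Proof.
move=> F_comp; apply: (computable_cons_comp F_comp).
- exact/computable_head/computable_nth.
- exact/computable_behead/computable_behead/computable_id.
- by move=> v; rewrite !size_behead size_tuple.
Qed.

Lemma computable_succ n A : computable n A -> computable n (fun v => (A v).+1).
Proof.
apply: (computable1_comp (f := succn)); exists RSucc; case/tupleP=> a v /=.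
by rewrite theadE.
Qed.

Lemma computable_const n k : computable n (fun=> k).
Proof. by elim: k => [|k IHk]; [exact: computable0|exact: computable_succ]. Qed.

Lemma computable_predn n A : computable n A -> computable n (fun v => (A v).-1).
Proof.
move=> A_comp; apply: eq_computable
  (computable_iteri (G := fun i _ _ => i) A_comp (computable0 n) _).
  by move=> v; case: (A v).
exact/computable_head/computable_nth.
Qed.

Lemma computable_iteri_state n : computable n.+2 (fun w => head 0 (behead w)).
Proof. exact/computable_head/computable_nth_behead/computable_nth. Qed.

Lemma computable_add n A B : computable n A -> computable n B ->
  computable n (fun v => A v + B v).
Proof.
move=> A_comp B_comp; apply: eq_computable
  (computable_iteri (G := fun _ u _ => u.+1) B_comp A_comp _).
  by move=> v; elim: (B v) => [|k IHk]; rewrite /= ?addn0 // IHk addnS.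
exact/computable_succ/computable_iteri_state.
Qed.

Lemma computable_sub n A B : computable n A -> computable n B ->
  computable n (fun v => A v - B v).
Proof.
move=> A_comp B_comp; apply: eq_computable
  (computable_iteri (G := fun _ u _ => u.-1) B_comp A_comp _).
  by move=> v; elim: (B v) => [|k IHk]; rewrite /= ?subn0 // IHk subnS.
exact/computable_predn/computable_iteri_state.
Qed.

Lemma computable_mul n A B : computable n A -> computable n B ->
  computable n (fun v => A v * B v).
Proof.
move=> A_comp B_comp; apply: eq_computable
  (computable_iteri (G := fun _ u v => u + A v) B_comp (computable0 n) _).
  by move=> v; elim: (B v) => [|k IHk]; rewrite /= ?muln0 // IHk mulnS addnC.
apply: computable_add; first exact: computable_iteri_state.
exact: (computable_weak (computable_weak A_comp)).
Qed.

Lemma computable_exp n A B : computable n A -> computable n B ->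
  computable n (fun v => A v ^ B v).
Proof.
move=> A_comp B_comp; have one_comp := computable_const n 1.
apply: eq_computable
  (computable_iteri (G := fun _ u v => u * A v) B_comp one_comp _).
  by move=> v; elim: (B v) => [|k IHk] //=; rewrite IHk expnSr.
apply: computable_mul; first exact: computable_iteri_state.
exact: (computable_weak (computable_weak A_comp)).
Qed.

Lemma computable_leq n A B : computable n A -> computable n B ->
  computable_pred n (fun v => A v <= B v).
Proof.
move=> A_comp B_comp; apply: eq_computable
  (computable_sub (computable_const n 1) (computable_sub A_comp B_comp)) => v.
by rewrite -subn_eq0; case: (A v - B v).
Qed.

Lemma computable_negb n p :
  computable_pred n p -> computable_pred n (fun v => ~~ p v).
Proof.
move=> p_comp.
apply: eq_computable (computable_sub (computable_const n 1) p_comp) => v.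
by case: (p v).
Qed.

Lemma computable_andb n p q : computable_pred n p -> computable_pred n q ->
  computable_pred n (fun v => p v && q v).
Proof.
move=> p_comp q_comp.
apply: eq_computable (computable_mul p_comp q_comp) => v.
by case: (p v) (q v) => -[].
Qed.

Lemma computable_implyb n p q : computable_pred n p -> computable_pred n q ->
  computable_pred n (fun v => p v ==> q v).
Proof.
move=> p_comp q_comp.
apply: eq_computable (computable_leq p_comp q_comp) => v.
by case: (p v) (q v) => -[].
Qed.

Lemma computable_eqn n A B : computable n A -> computable n B ->
  computable_pred n (fun v => A v == B v).
Proof.
move=> A_comp B_comp.
have le_comp := computable_leq A_comp B_comp.
have ge_comp := computable_leq B_comp A_comp.
by apply: eq_computable (computable_andb le_comp ge_comp) => v; rewrite eqn_leq.
Qed.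

Lemma computable_if n p A B :
  computable_pred n p -> computable n A -> computable n B ->
  computable n (fun v => if p v then A v else B v).
Proof.
move=> p_comp A_comp B_comp; apply: eq_computable
  (computable_add (computable_mul p_comp A_comp)
    (computable_mul (computable_negb p_comp) B_comp)) => v.
by case: (p v); rewrite /= ?mul1n ?mul0n ?addn0.
Qed.

Lemma computable_sum n A B (p : nat -> seq nat -> bool) F :
  computable n A -> computable n B ->
  computable_pred n.+1 (fun w => p (head 0 w) (behead w)) ->
  computable n.+1 (fun w => F (head 0 w) (behead w)) ->
  computable n (fun v => \sum_(A v <= i < B v | p i v) F i v).
Proof.
move=> A_comp B_comp p_comp F_comp.
pose term i v := if p i v && (A v <= i) then F i v else 0.
apply: eq_computable (computable_iteri (G := fun i u v => u + term i v)
  B_comp (computable0 n) _) => [v|].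
  rewrite (big_nat_widenl _ 0) // big_mkcond /=.
  by elim: (B v) => [|k IHk]; [rewrite big_geq|rewrite big_nat_recr //= -IHk].
apply: computable_add (computable_iteri_state n) _.
apply: computable_weak_cons.
apply: computable_if (computable_const _ 0) => //; apply: computable_andb => //.
apply: computable_leq; first exact: computable_weak.
exact/computable_head/computable_nth.
Qed.

Lemma computable_has n A B (p : nat -> seq nat -> bool) :
  computable n A -> computable n B ->
  computable_pred n.+1 (fun w => p (head 0 w) (behead w)) ->
  computable_pred n (fun v => has (p^~ v) (index_iota (A v) (B v))).
Proof.
move=> A_comp B_comp p_comp.
have count_comp := computable_sum (p := p) (F := fun _ _ => 1)
  A_comp B_comp p_comp (computable_const _ 1).
apply: eq_computable (computable_leq (computable_const _ 1) count_comp) => v.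
by rewrite sum1_count -has_count.
Qed.

Lemma computable_all n A B (p : nat -> seq nat -> bool) :
  computable n A -> computable n B ->
  computable_pred n.+1 (fun w => p (head 0 w) (behead w)) ->
  computable_pred n (fun v => all (p^~ v) (index_iota (A v) (B v))).
Proof.
move=> A_comp B_comp /computable_negb p_comp.
have has_comp :=
  computable_has (p := fun i v => ~~ p i v) A_comp B_comp p_comp.
apply: eq_computable (computable_negb has_comp) => v.
by rewrite -all_predC; congr nat_of_bool; apply: eq_all => i /=; rewrite negbK.
Qed.

Lemma computable_least n (p : nat -> seq nat -> bool) (Z : seq nat -> nat) :
  computable_pred n.+1 (fun w => p (head 0 w) (behead w)) ->
  (forall v : n.-tuple nat, p (Z v) v) ->
  (forall (v : n.-tuple nat) i, i < Z v -> ~~ p i v) ->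
  computable n Z.
Proof.
move=> /computable_negb[c c_eval] pZ Z_min; exists (RMu c) => v /=; split.
  by have := c_eval [tuple of Z v :: v]; rewrite /= pZ.
move=> i ltiZ; exists 0.
by have := c_eval [tuple of i :: v]; rewrite /= Z_min.
Qed.

Lemma before_find_iota T (p : pred nat) i : i < find p (iota 0 T) -> ~~ p i.
Proof.
move=> ltif; have := before_find 0 ltif; rewrite nth_iota ?add0n => [->//|].
by apply: leq_trans ltif _; rewrite -[leqRHS](size_iota 0) find_size.
Qed.

Lemma find_iotaP T (p : pred nat) :
  find p (iota 0 T) < T -> p (find p (iota 0 T)).
Proof.
move=> ltfT; have := @nth_find _ 0 p (iota 0 T).
by rewrite has_find size_iota nth_iota // add0n; exact.
Qed.

Lemma find_iota_lt T (p : pred nat) z : z < T -> p z -> find p (iota 0 T) < T.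
Proof.
move=> ltzT pz; rewrite -[ltnRHS](size_iota 0) -has_find.
by apply/hasP; exists z; rewrite ?mem_iota.
Qed.

Lemma find_iota_eq T (p : pred nat) z :
  z < T -> p z -> (forall i, i < z -> ~~ p i) -> find p (iota 0 T) = z.
Proof.
move=> ltzT pz z_min; have pf := find_iotaP (find_iota_lt ltzT pz).
by case: (ltngtP (find p (iota 0 T)) z) => // [/z_min|/before_find_iota];
  rewrite ?pf ?pz.
Qed.

Lemma computable_find n B (p : nat -> seq nat -> bool) :
  computable n B -> computable_pred n.+1 (fun w => p (head 0 w) (behead w)) ->
  computable n (fun v => find (p^~ v) (iota 0 (B v))).
Proof.
move=> B_comp p_comp.
have index_comp : computable n.+1 (head 0).
  exact/computable_head/computable_nth.
apply: (@computable_least _ (fun i v => (i < B v) ==> p i v)).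
- apply: computable_implyb => //.
  by apply: computable_leq; [exact: computable_succ|exact: computable_weak].
- by move=> v; apply/implyP/find_iotaP.
- move=> v i ltif; rewrite negb_imply (before_find_iota ltif) andbT.
  by apply: leq_trans ltif _; rewrite -[leqRHS](size_iota 0) find_size.
Qed.

Lemma computable_divn n A B : computable n A -> computable n B ->
  computable n (fun v => A v %/ B v).
Proof.
move=> A_comp B_comp.
have index_comp : computable n.+1 (head 0).
  exact/computable_head/computable_nth.
apply: (@computable_least _ (fun i v => (0 < B v) ==> (A v < i.+1 * B v))).
- apply: computable_implyb; apply: computable_leq; try exact: computable_const.
  + exact: computable_weak.
  + exact/computable_succ/computable_weak.
  + by apply: computable_mul; [exact: computable_succ|exact: computable_weak].
- by move=> v; apply/implyP => B_gt0; exact: ltn_ceil.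
- move=> v i lti; case: (posnP (B v)) lti => [->|B_gt0]; first by rewrite divn0.
  by rewrite leq_divRL // -leqNgt.
Qed.

Lemma computable_odd n A :
  computable n A -> computable_pred n (fun v => odd (A v)).
Proof.
move=> A_comp; have two_comp := computable_const n 2.
have half_comp := computable_divn A_comp two_comp.
apply: eq_computable
  (computable_sub A_comp (computable_mul half_comp two_comp)) => v.
by rewrite -modn2 {1}(divn_eq (A v) 2) addKn.
Qed.

Lemma computable_trunc_log n A :
  computable n A -> computable n (fun v => trunc_log 2 (A v)).
Proof.
move=> A_comp; apply: (@computable_least _ (fun i v => A v < 2 ^ i.+1)).
- apply: computable_leq; first exact/computable_succ/computable_weak.
  apply: computable_exp; first exact: computable_const.
  exact/computable_succ/computable_head/computable_nth.
- by move=> v; exact: trunc_log_ltn.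
- move=> v i; case: (posnP (A v)) => [->|A_gt0 lti].
    by rewrite trunc_log0.
  rewrite -leqNgt; apply: leq_trans (trunc_logP (isT : 1 < 2) A_gt0).
  by rewrite leq_exp2l.
Qed.

Ltac computability_step := first
  [ assumption
  | match goal with
    | f_comp : computable1 _ |- _ => apply: (computable1_comp f_comp)
    | f_comp : computable2 _ |- _ => apply: (computable2_comp f_comp)
    | f_comp : computable3 _ |- _ => apply: (computable3_comp f_comp)
    | f_comp : computable4 _ |- _ => apply: (computable4_comp f_comp)
    end
  | apply: computable_const | apply: computable_nth
  | apply: computable_nth_behead | apply: computable_head
  | apply: computable_all | apply: computable_has | apply: computable_odd
  | apply: computable_implyb | apply: computable_andb | apply: computable_negb
  | apply: computable_leq | apply: computable_eqn | apply: computable_exp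
  | apply: computable_succ | apply: computable_predn
  | apply: computable_add | apply: computable_sub | apply: computable_mul
  | apply: computable_divn | apply: computable_trunc_log
  | apply: computable_if | apply: computable_sum | apply: computable_find
  | apply: computable_iteri ].
Ltac computability :=
  rewrite ?/computable1 ?/computable3 ?/computable4; repeat computability_step.

(** * Step-bounded evaluation *)

(* [run c s v] is [z.+1] if the computation of [c] on [v] is seen to halt with
   value [z] while all unbounded searches are cut off at [s], and [0]
   otherwise. *)
Fixpoint run n (c : recf n) (s : nat) (v : seq nat) : nat :=
  match c with
  | RZero _ => 1
  | RSucc => (head 0 v).+2
  | RProj _ i => (nth 0 v i).+1
  | RComp m _ f g =>
      if all (fun i => run (g i) s v != 0) (enum 'I_m)
      then run f s [seq (run (g i) s v).-1 | i <- enum 'I_m] else 0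
  | RPrec _ f g =>
      iteri (head 0 v)
        (fun i u => if u == 0 then 0 else run g s [:: i, u.-1 & behead v])
        (run f s (behead v))
  | RMu _ f =>
      let z := find (fun i => run f s (i :: v) <= 1) (iota 0 s) in
      if run f s (z :: v) == 1 then z.+1 else 0
  end.

Lemma computable_all_seq n (T : Type) (r : seq T) (p : T -> seq nat -> bool) :
  (forall i, computable_pred n (p i)) ->
  computable_pred n (fun v => all (p^~ v) r).
Proof.
move=> p_comp; elim: r => [|i r IHr]; first exact: (computable_const n 1).
exact: computable_andb.
Qed.

Lemma computable_map_enum n m (F : 'I_m -> seq nat -> nat) :
  (forall i, computable n (F i)) ->
  computable_seq n (fun v => [seq F i v | i <- enum 'I_m]).
Proof.
move=> F_comp k; case: (ltnP k m) => ltkm.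
  pose k_ord := Ordinal ltkm; apply: eq_computable (F_comp k_ord) => v.
  by rewrite (nth_map k_ord) ?size_enum_ord // (nth_ord_enum _ k_ord).
apply: eq_computable (computable0 n) => v.
by rewrite nth_default // size_map size_enum_ord.
Qed.

Lemma computable_bounded_search n (F : nat -> seq nat -> nat) :
  computable n.+2 (fun w => F (head 0 w) (behead w)) ->
  computable n.+1 (fun w =>
    find (fun i => F (head 0 w) (i :: behead w) <= 1) (iota 0 (head 0 w))).
Proof.
move=> F_comp.
apply: (computable_find (p := fun i w => F (head 0 w) (i :: behead w) <= 1)).
  by computability.
computability; apply: (computable_cons_comp F_comp).
- by computability.
- apply: computable_cons; first by computability.
  by do 2!apply: computable_behead; exact: computable_id.
- by move=> v; rewrite /= !size_behead size_tuple.
Qed.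

Lemma computable_run n (c : recf n) :
  computable n.+1 (fun w => run c (head 0 w) (behead w)).
Proof.
elim: c => {n} [n||n i|m n f run_f g run_g|n f run_f g run_g|n f run_f] /=.
- exact: computable_const.
- by computability.
- by computability.
- apply: computable_if; last exact: computable_const.
    by apply: computable_all_seq => i; computability; exact: run_g.
  apply: (computable_cons_comp run_f).
  + by computability.
  + by apply: computable_map_enum => i; computability; exact: run_g.
  + by move=> v; rewrite size_map size_enum_ord.
- apply: (computable_iteri (n := n.+2) (B := fun w => head 0 (behead w))
    (F := fun w => run f (head 0 w) (behead (behead w)))
    (G := fun i u w => if u == 0 then 0 else
      run g (head 0 w) [:: i, u.-1 & behead (behead w)])).
  + by computability.
  + exact: computable_weak_cons.
  + computability; apply: (computable_cons_comp run_g).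
    * by computability.
    * do 2!(apply: computable_cons; first by computability).
      by do 4!apply: computable_behead; exact: computable_id.
    * by move=> v; rewrite /= !size_behead size_tuple.
- have search_comp := computable_bounded_search run_f.
  computability; apply: (computable_cons_comp run_f).
  + by computability.
  + by apply: computable_cons => //; exact/computable_behead/computable_id.
  + by move=> v; rewrite /= size_behead size_tuple.
Qed.

Lemma run_sound n (c : recf n) s (v : n.-tuple nat) z :
  run c s v = z.+1 -> eval c v z.
Proof.
elim: c v z => {n} [n||n i|m n f IHf g IHg|n f IHf g IHg|n f IHf] v z.
- by case.
- by case=> <-; rewrite /= /thead (tnth_nth 0) nth0.
- by case=> <-; rewrite /= (tnth_nth 0).
- rewrite /=; case: allP => // all_halt run_f.
  exists [tuple (run (g i) s v).-1 | i < m]; split; last exact: IHf.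
  move=> i; apply: IHg; rewrite tnth_mktuple prednK // lt0n.
  by apply: all_halt; rewrite mem_enum.
- case/tupleP: v => k v; rewrite eval_precE /=.
  elim: k z => [|k IHk] z /=; first exact: IHf.
  case: eqP => // /eqP; rewrite -lt0n => halts run_g.
  exists (iteri k (fun i u =>
    if u == 0 then 0 else run g s [:: i, u.-1 & v]) (run f s v)).-1.
  split; first by apply: IHk; rewrite prednK.
  exact: (IHg [tuple of k :: _ :: v]).
- rewrite /=; case: eqP => // run_f [<-]; set k := find _ _ in run_f *.
  split; first exact: (IHf [tuple of k :: v]).
  move=> i /before_find_iota; rewrite -ltnNge => gt1.
  exists (run f s (i :: v)).-2; apply: (IHf [tuple of i :: v]) => /=.
  by case: run gt1 => [|[]].
Qed.

Lemma run_complete n (c : recf n) (v : n.-tuple nat) z :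
  eval c v z -> \forall s \near \oo, run c s v = z.+1.
Proof.
elim: c v z => {n} [n||n i|m n f IHf g IHg|n f IHf g IHg|n f IHf] v z.
- by move=> /= ->; exact: nearW.
- by move=> /= ->; apply: nearW => s; rewrite /thead (tnth_nth 0) nth0.
- by move=> /= ->; apply: nearW => s; rewrite (tnth_nth 0).
- move=> [w [g_w f_z]]; near=> s => /=.
  have run_g : forall i, run (g i) s v = (tnth w i).+1.
    by near: s; apply: filter_forall => i; exact: IHg (g_w i).
  rewrite (_ : all _ _); last by apply/allP => i _; rewrite run_g.
  rewrite (eq_map (g := tnth w)) => [|i]; last by rewrite run_g.
  by rewrite map_tnth_enum; near: s; exact: IHf.
- case/tupleP: v => k v; rewrite eval_precE /=.
  elim: k z => [|k IHk] z /=; first exact: IHf.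
  move=> [u [/IHk run_k /IHg run_g]].
  by apply: filterS2 run_k run_g => s /= -> <-.
- move=> [f_z before_z].
  have /choice[u f_u] (i : 'I_z) := before_z i (ltn_ord i).
  near=> s => /=.
  have run_z : run f s (z :: v) = 1 by near: s; exact: (IHf _ _ f_z).
  have run_u : forall i : 'I_z, run f s (val i :: v) = (u i).+2.
    by near: s; apply: filter_forall => i; exact: (IHf _ _ (f_u i)).
  rewrite (@find_iota_eq _ _ z) ?run_z //.
    by near: s; exact: nbhs_infty_gt.
  by move=> i ltiz; rewrite (run_u (Ordinal ltiz)).
Unshelve. all: by end_near. Qed.

Lemma eval_inj n (c : recf n) v z z' : eval c v z -> eval c v z' -> z = z'.
Proof.
move=> /run_complete run_z /run_complete run_z'.
by have [s [-> []]] := filter_ex (filterI run_z run_z').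
Qed.

(** * Unbounded search *)

Lemma computable_choice (p : nat -> nat -> bool) :
  computable2 (fun T n => p T n) -> (forall n, exists T, p T n) ->
  exists2 f, computable1 f & forall n, p (f n) n.
Proof.
move=> p_comp p_ex; exists (fun n => ex_minn (p_ex n)); last first.
  by move=> n; case: ex_minnP.
apply: (@computable_least _ (fun T v => p T (nth 0 v 0))) => [|v|v i].
- by computability.
- by case: ex_minnP.
- case: ex_minnP => T _ T_min lti; apply/negP => /T_min.
  by rewrite leqNgt lti.
Qed.

Lemma search_code (p : nat -> nat -> bool) (out : nat -> nat -> nat) :
  computable2 (fun T n => p T n) -> computable2 out ->
  exists c : recf 1, forall n z, eval c [tuple n] z <->
    exists T, [/\ p T n, forall i, i < T -> ~~ p i n & z = out T n].
Proof.
move=> p_comp [c c_eval].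
have [test test_eval] : computable2 (fun T n => ~~ p T n).
  by apply/computable2P; computability.
pose args (i : 'I_2) : recf 1 := if val i is 0 then RMu test else RProj ord0.
exists (RComp c args) => n z.
split=> [[w]|[T [pT T_min ->]]].
- case/tupleP: w => T w; case/tupleP: w => n' w; rewrite (tuple0 w).
  move=> [w_args out_z].
  have := w_args (lift ord0 ord0); have [] := w_args ord0.
  rewrite /= !(tnth_nth 0) /= => test0 test_before n'E; exists T; split.
  + by move/(eval_inj (test_eval T n)): test0; case: (p T n).
  + by move=> i /test_before[u /(eval_inj (test_eval i n))]; case: (p i n).
  + by apply: eval_inj out_z _; rewrite n'E; exact: c_eval.
- exists [tuple T; n]; split; last exact: c_eval.
  case=> -[|[|//]] lti /=; rewrite (tnth_nth 0) /=; last first.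
    by rewrite (tnth_nth 0).
  split; first by have := test_eval T n; rewrite pT.
  by move=> i ltiT; exists 0; have := test_eval i n; rewrite T_min.
Qed.

(** * Strings and complexity *)

Lemma string_code_bounds p :
  2 ^ size p <= (string_code p).+1 < 2 ^ (size p).+1.
Proof.
elim: p => // b p /andP[lower upper]; rewrite /= [2 ^ (size p).+2]expnS.
by move: lower upper; rewrite !expnS; move: (2 ^ size p) => a; case: b; lia.
Qed.

Lemma size_string_code p : size p = trunc_log 2 (string_code p).+1.
Proof. by apply/esym/trunc_log_eq => //; exact: string_code_bounds. Qed.

Lemma string_code_surj n : exists p, string_code p = n.
Proof.
elim/ltn_ind: n => -[|n] IHn; first by exists [::].
have [p codep] := IHn n./2 ltac:(lia).
by exists (odd n :: p); rewrite /= codep; lia.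
Qed.

Lemma exists_decompressor (c : recf 1) : exists E : seq bool -> option nat,
  forall p N, E p = Some N <-> eval c [tuple string_code p] N.
Proof.
suff /choice[E E_eval] : forall p, exists o : option nat, forall N,
    o = Some N <-> eval c [tuple string_code p] N by exists E.
move=> p; case: (pselect (exists N, eval c [tuple string_code p] N)).
  move=> [N evalN]; exists (Some N) => N'.
  by split=> [[<-]//|/(eval_inj evalN)->].
move=> diverges; exists None => N; split=> // evalN.
by case: diverges; exists N.
Qed.

Lemma complexity_leP D N n :
  complexity_le D N n <-> exists2 p, size p <= n & D p = Some N.
Proof.
split=> [[k [[[p Dp <-] _] lekn]]|[p lepn Dp]]; first by exists p.
have sizes_ex : exists k, `[< exists2 q, D q = Some N & size q = k >].
  by exists (size p); apply/asboolP; exists p.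
case: (ex_minnP sizes_ex) => k /asboolP[q Dq szq] k_min; exists k; split.
  split; first by exists q.
  by move=> l [r Dr szr]; apply: k_min; apply/asboolP; exists r.
by apply: leq_trans lepn; apply: k_min; apply/asboolP; exists p.
Qed.

Lemma is_B_exists D p N n : size p <= n -> D p = Some N ->
  exists2 b, is_B D n b & N <= b.
Proof.
move=> lepn Dp.
have descr_ex : exists M, `[< complexity_le D M n >].
  by exists N; apply/asboolP/complexity_leP; exists p.
have descr_le M : `[< complexity_le D M n >] ->
    M <= \max_(q : n.-bseq bool) odflt 0 (D q).
  move=> /asboolP/complexity_leP[q leqn Dq].
  by apply: leq_trans (leq_bigmax (Bseq leqn)); rewrite /= Dq.
case: (ex_maxnP descr_ex descr_le) => b /asboolP descr_b b_max; exists b.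
  by split=> // M descrM; apply: b_max; apply/asboolP.
by apply: b_max; apply/asboolP/complexity_leP; exists p.
Qed.

Lemma not_worseP D E : not_worse D E -> exists c, forall p N, E p = Some N ->
  exists2 q, size q <= size p + c & D q = Some N.
Proof.
move=> [c D_le]; exists c => p N Ep.
have [k [kE lekp]] : complexity_le E N (size p).
  by apply/complexity_leP; exists p.
have /complexity_leP[q leqk Dq] := D_le _ _ kE; exists q => //.
by apply: leq_trans leqk _; rewrite leq_add2r.
Qed.

Lemma optimal_prefix_has_program P :
  optimal_prefix_decompressor P -> exists p N, P p = Some N.
Proof.
move=> [_ P_opt].
pose E (p : seq bool) : option nat := if p is [::] then Some 0 else None.
suff E_prefix : prefix_decompressor E.
  have [c /(_ [::] 0 erefl)[q _ Pq]] := not_worseP (P_opt E E_prefix).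
  by exists q, 0.
split; last by move=> [|a p] [|b q].
exists (RMu (RProj (lift ord0 ord0))) => -[|b p] N; split=> //=.
- by case=> <-.
- by move=> [_]; case: N => // N /(_ 0 isT)[].
- by case.
Qed.

Lemma decompressor_run P : decompressor P ->
  exists2 out : nat -> nat -> nat, computable2 out &
    (forall s n N, out s n = N.+1 ->
      exists2 p, string_code p = n & P p = Some N) /\
    (forall p N, P p = Some N ->
      \forall s \near \oo, out s (string_code p) = N.+1).
Proof.
move=> [c c_eval]; exists (fun s n => run c s [:: n]); last split.
- apply/computable2P; apply: eq_computable (computable_run c) => v.
  by case/tupleP: v => a v; case/tupleP: v => b v; rewrite (tuple0 v).
- move=> s n N out_n; have [p codep] := string_code_surj n; exists p => //.
  by apply/c_eval; apply: (@run_sound _ c s); rewrite codep.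
- by move=> p N /c_eval; exact: run_complete.
Qed.

(** * Kraft's inequality *)

Lemma card_extensions (T : finType) K (p : K.-bseq T) :
  #|T| ^ (K - size p) <= #|[pred t : K.-tuple T | prefix p t]|.
Proof.
pose extend (u : (K - size p).-tuple T) : K.-tuple T :=
  tcast (subnKC (size_bseq p)) [tuple of in_tuple p ++ u].
have extendE u : extend u = p ++ u :> seq T by rewrite val_tcast.
have extend_inj : injective extend.
  move=> u u' /(congr1 val); rewrite /= !extendE => /eqP.
  by rewrite eqseq_cat // eqxx => /eqP/val_inj.
rewrite -card_tuple -(card_imset _ extend_inj).
apply/subset_leq_card/fintype.subsetP => t.
by case/imsetP => u _ ->; rewrite inE extendE prefix_prefix.
Qed.

Lemma prefix_comparable (T : eqType) (p q t : seq T) :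
  prefix p t -> prefix q t -> size p <= size q -> prefix p q.
Proof.
rewrite !prefixE => /eqP pE /eqP qE lepq.
by rewrite -qE -{2}pE take_takel.
Qed.

Lemma kraft (T : finType) K (A : pred (seq T)) :
  {in A &, forall p q, prefix p q -> p = q} ->
  \sum_(p : K.-bseq T | A p) #|T| ^ (K - size p) <= #|T| ^ K.
Proof.
move=> A_pf.
apply: (@leq_trans
    (\sum_(p : K.-bseq T | A p) #|[pred t : K.-tuple T | prefix p t]|)).
  by apply: leq_sum => p _; exact: card_extensions.
under eq_bigr => p _ do rewrite -sum1_card big_mkcond /=.
rewrite exchange_big /= -card_tuple -sum1_card; apply: leq_sum => t _.
rewrite -big_mkcondr sum1_card; apply/card_le1_eqP => p q.
move=> /andP[Ap p_t] /andP[Aq q_t]; apply: val_inj.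
have [le_size|/ltnW le_size] := leqP (size q) (size p).
  by apply: A_pf => //; exact: prefix_comparable q_t p_t le_size.
by apply/esym/A_pf => //; exact: prefix_comparable p_t q_t le_size.
Qed.

(** * Sums of powers of two *)

Lemma leq_sum_inj (I J : finType) (Q : pred I) (phi : I -> J) (F : J -> nat) :
  {in Q &, injective phi} -> \sum_(i | Q i) F (phi i) <= \sum_j F j.
Proof.
move=> phi_inj; rewrite -(big_imset F phi_inj); move: (imset _ _) => B.
by rewrite [leqRHS](bigID (mem B)) leq_addr.
Qed.

Lemma sum_distinct_exp2 (I : finType) (Q : pred I) (e : I -> nat) a :
  {in Q &, injective e} -> (forall i, Q i -> 2 ^ e i <= a) ->
  \sum_(i | Q i) 2 ^ e i <= 2 * a.
Proof.
move=> e_inj e_le; case: (posnP a) => [a0|a_gt0].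
  by rewrite big_pred0 // => i; apply/negP => /e_le; rewrite a0 leqNgt expn_gt0.
set L := trunc_log 2 a.
have e_lt i : Q i -> e i < L.+1 by move=> /e_le; exact: trunc_log_max.
have inord_e i : Q i -> 2 ^ e i = 2 ^ (inord (e i) : 'I_L.+1).
  by move=> /e_lt ?; rewrite inordK.
rewrite (eq_bigr _ inord_e).
apply: leq_trans (leq_sum_inj (fun j : 'I_L.+1 => 2 ^ j) _) _.
  move=> i j Qi Qj /(congr1 val); rewrite /= !inordK ?e_lt //; exact: e_inj.
rewrite -[leqLHS]mul1n -(predn_exp 2) (leq_trans (leq_pred _)) //.
by rewrite expnS leq_mul2l trunc_logP.
Qed.

Lemma sum_exp2_sub K : \sum_(y < K) 2 ^ (K - y) <= 2 ^ K.+1.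
Proof.
rewrite expnS; apply: sum_distinct_exp2 => [y z _ _ /= eq_sub|y _].
  by apply: val_inj => /=; have := ltn_ord y; have := ltn_ord z; lia.
by rewrite leq_exp2l // leq_subr.
Qed.

Lemma kraft_upto K (A : pred (seq bool)) :
  {in A &, forall p q, prefix p q -> p = q} ->
  \sum_(y < K) #|[pred p : K.-bseq bool | A p & size p <= y]| * 2 ^ (K - y)
    <= 2 ^ K.+1.
Proof.
move=> A_pf; have := kraft K A_pf.
rewrite card_bool expnS => /(leq_mul (leqnn 2)).
apply: leq_trans; rewrite big_distrr /=.
under eq_bigr => y _ do rewrite -sum1_card big_distrl big_mkcondr /=.
rewrite exchange_big; apply: leq_sum => p Ap /=.
rewrite -big_mkcond /=; under eq_bigr do rewrite mul1n.
apply: (sum_distinct_exp2 (I := 'I_K)) => [y z _ _ /= eq_sub|y le_y].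
  by apply: val_inj => /=; have := ltn_ord y; have := ltn_ord z; lia.
by rewrite leq_exp2l // leq_sub2l.
Qed.

(** * Finite approximations to the family of pairs *)

Section ApproximatePairs.
Variables f g : nat -> nat -> nat.

Definition approx_pair K x y :=
  has (fun n => (f n K == x) && (g n K == y)) (index_iota 0 K).

(* This is [2 ^ K] times the sum of [2 ^ (x - y)] over the pairs above [c]. *)
Definition pair_mass c K :=
  \sum_(c.+1 <= x < K) \sum_(0 <= y < K | (x <= y) && approx_pair K x y)
    2 ^ (K + x - y).

Lemma computable_approx_pair : computable2 f -> computable2 g ->
  computable3 (fun K x y => approx_pair K x y).
Proof. by move=> f_comp g_comp; rewrite /approx_pair; computability. Qed.

Lemma computable_pair_mass :
  computable2 f -> computable2 g -> computable2 pair_mass.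
Proof.
move=> f_comp g_comp; have pair_comp := computable_approx_pair f_comp g_comp.
by apply/computable2P; rewrite /pair_mass; computability.
Qed.

Lemma pair_massE c K : pair_mass c K =
  \sum_(x < K) \sum_(y < K | [&& c < x, x <= y & approx_pair K x y])
    2 ^ (K + x - y).
Proof.
rewrite /pair_mass big_geq_mkord big_mkcond; apply: eq_bigr => x _ /=.
by rewrite big_mkord; case: ifP => // _; rewrite big_pred0.
Qed.

Section Limits.
Variables x y : nat -> nat.
Hypothesis xy_inj : injective (fun n => (x n, y n)).
Hypothesis x_le_y : forall n, x n <= y n.
Hypothesis f_x : forall n, \forall k \near \oo, f n k = x n.
Hypothesis g_y : forall n, \forall k \near \oo, g n k = y n.

Lemma small_x_mass_le M K c : (forall n, n < M -> y n < K) ->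
  \sum_(n < M | x n <= c) 2 ^ (K + x n - y n) <= 2 ^ c.+2 * 2 ^ K.
Proof.
move=> y_lt; pose F (p : 'I_c.+1 * 'I_K) := 2 ^ p.1 * 2 ^ (K - p.2).
pose phi (n : 'I_M) := (inord (x n) : 'I_c.+1, Ordinal (y_lt n (ltn_ord n))).
rewrite (eq_bigr (F \o phi)) => [|n le_c]; last first.
  rewrite /F /= inordK // -expnD; congr expn.
  by have := y_lt n (ltn_ord n); lia.
apply: leq_trans (leq_sum_inj F _) _.
  move=> n n' le_c le_c' [/(congr1 val)]; rewrite /= !inordK // => eq_x eq_y.
  by apply: val_inj; apply: xy_inj; rewrite /= eq_x eq_y.
rewrite -(pair_bigA _ (fun a b => F (a, b))) /F /= -big_distrlr /=.
have -> : 2 ^ c.+2 * 2 ^ K = 2 ^ c.+1 * 2 ^ K.+1 by rewrite -!expnD addSnnS.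
apply: leq_mul (sum_exp2_sub K); rewrite -[leqLHS]mul1n -(predn_exp 2).
exact: leq_pred.
Qed.

Lemma pair_mass_ge M c : \forall K \near \oo,
  \sum_(n < M | c < x n) 2 ^ (K + x n - y n) <= pair_mass c K.
Proof.
near=> K.
have le_MK : M <= K by near: K; exact: nbhs_infty_ge.
have limits : forall n : 'I_M, [/\ f n K = x n, g n K = y n & y n < K].
  near: K; apply: filter_forall => n; near=> K.
  by split; near: K; [exact: f_x|exact: g_y|exact: nbhs_infty_gt].
have y_lt (n : 'I_M) : y n < K by case: (limits n).
have x_lt (n : 'I_M) : x n < K := leq_ltn_trans (x_le_y n) (y_lt n).
pose phi (n : 'I_M) := (Ordinal (x_lt n), Ordinal (y_lt n)).
pose Q a b := [&& c < a, a <= b & approx_pair K a b].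
pose F (p : 'I_K * 'I_K) := if Q p.1 p.2 then 2 ^ (K + p.1 - p.2) else 0.
have -> : pair_mass c K = \sum_p F p.
  rewrite -(pair_bigA _ (fun a b => F (a, b))) pair_massE.
  by apply: eq_bigr => a _; rewrite big_mkcond.
rewrite (eq_bigr (F \o phi)) => [|n lt_c].
  apply: leq_sum_inj => n n' _ _ [eq_x eq_y].
  by apply/val_inj/xy_inj; rewrite /= eq_x eq_y.
rewrite /F /Q /= lt_c x_le_y /=; suff -> : approx_pair K (x n) (y n) by [].
apply/hasP; exists (val n).
  by rewrite mem_index_iota (leq_trans (ltn_ord n)).
by have [-> -> _] := limits n; rewrite !eqxx.
Unshelve. all: by end_near. Qed.

Hypothesis diverges : forall A, exists M, \forall K \near \oo,
  A * 2 ^ K <= \sum_(n < M) 2 ^ (K + x n - y n).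

Lemma pair_mass_unbounded A c : \forall K \near \oo, A * 2 ^ K <= pair_mass c K.
Proof.
have [M total_ge] := diverges (A + 2 ^ c.+2).
near=> K; rewrite -(leq_add2r (2 ^ c.+2 * 2 ^ K)) -mulnDl.
apply: leq_trans (near total_ge K _) _ => //.
rewrite (bigID (fun n : 'I_M => c < x n)) /= leq_add //.
  by near: K; exact: pair_mass_ge.
under eq_bigl do rewrite -leqNgt; apply: small_x_mass_le => n ltnM.
suff y_lt : forall n : 'I_M, y n < K by exact: (y_lt (Ordinal ltnM)).
by near: K; apply: filter_forall => i; exact: nbhs_infty_gt.
Unshelve. all: by end_near. Qed.

End Limits.

(* The pairs above [2 * c] have more mass than the a priori probability can pay
   for in game [c], and than Kraft's inequality leaves to a prefix-free
   decompressor. *)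
Definition rich K c := 2 ^ (K + 3 * c).+3 < pair_mass (2 * c) K.

Lemma rich_horizon : computable2 f -> computable2 g ->
  (forall A c, \forall K \near \oo, A * 2 ^ K <= pair_mass c K) ->
  exists2 horizon, computable1 horizon & forall c, rich (horizon c) c.
Proof.
move=> f_comp g_comp unbounded; apply: computable_choice => [|c].
  have mass_comp := computable_pair_mass f_comp g_comp.
  by apply/computable2P; rewrite /rich; computability.
have [K mass_ge] := filter_ex (unbounded (2 ^ (3 * c).+3).+1 (2 * c)).
exists K; apply: leq_trans mass_ge; rewrite -!addnS addnC expnD.
by rewrite ltn_pmul2r ?expn_gt0.
Qed.

End ApproximatePairs.

(** * Greedy play described by a decompressor *)

Section GreedyPlay.
Variable legal : nat -> nat -> nat -> nat -> bool.
Hypothesis legal_comp : computable4 (fun c t v N => legal c t v N).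
Hypothesis legal_lt : forall c t v N, legal c t v N -> v < N.

(* The position of game [c] before turn [t].  All searches are cut off at [T]: a
   value below [T] is the true position, and [T] means that a search has failed.
   The start at [1] leaves a number below every position. *)
Definition position c T t :=
  iteri t (fun i v => find (legal c i v) (iota 0 T)) 1.

Lemma position_step c T t : position c T t.+1 < T ->
  legal c t (position c T t) (position c T t.+1).
Proof. exact: find_iotaP. Qed.

Lemma position_gt0 c T t : position c T t < T -> 0 < position c T t.
Proof. by case: t => // t /position_step/legal_lt; exact: leq_ltn_trans. Qed.

Lemma position_stable c T T' t :
  position c T t < T -> T <= T' -> position c T' t = position c T t.
Proof.
move=> + leTT'; elim: t => // t IHt found.
have step := position_step found; have lt_step := legal_lt step.
rewrite [LHS]/= -/(position c T' t) IHt ?(ltn_trans lt_step) //.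
apply: find_iota_eq => // [|i]; first exact: leq_trans leTT'.
exact: before_find_iota.
Qed.

Lemma computable_position : computable3 position.
Proof.
rewrite /computable3 /position.
apply: (computable_iteri (G := fun i u v =>
  find (legal (nth 0 v 0) i u) (iota 0 (nth 0 v 1)))); by computability.
Qed.

(* The position at turn [t] of game [c] is described by a string of length
   [level t + c + 1], so that game [c] uses at most the fraction [2 ^ - (c + 1)]
   of the strings of each length. *)
Definition level t := trunc_log 2 t.+1.
Definition slot c t := 2 ^ (level t + c.+1) + t.
Definition slot_turn n := n - 2 ^ trunc_log 2 n.+1.
Definition slot_game n := (trunc_log 2 n.+1 - level (slot_turn n)).-1.

Lemma trunc_log_slot c t : trunc_log 2 (slot c t).+1 = level t + c.+1.
Proof.
apply: trunc_log_eq => //; rewrite /slot -addnS leq_addr /= expnS mul2n -addnn.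
rewrite ltn_add2l (leq_trans (trunc_log_ltn t.+1 (isT : 1 < 2))) //.
by rewrite leq_exp2l // addnS ltnS leq_addr.
Qed.

Lemma slotK c t : (slot_game (slot c t) = c) * (slot_turn (slot c t) = t).
Proof.
have turnE : slot_turn (slot c t) = t.
  by rewrite /slot_turn trunc_log_slot addKn.
by split=> //; rewrite /slot_game trunc_log_slot turnE addKn.
Qed.

Lemma position_decompressor : exists2 E, decompressor E &
  forall c t T p, string_code p = slot c t -> position c T t < T ->
    E p = Some (position c T t).
Proof.
have pos_comp := computable_position.
have [||code codeP] := @search_code
    (fun T n => position (slot_game n) T (slot_turn n) < T)
    (fun T n => position (slot_game n) T (slot_turn n)).
1,2: by apply/computable2P; rewrite /slot_game /level /slot_turn; computability.
have [E E_eval] := exists_decompressor code; exists E; first by exists code.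
move=> c t T p codep found; apply/E_eval/codeP; rewrite codep !slotK.
have found_ex : exists S, position c S t < S by exists T.
case: (ex_minnP found_ex) => S foundS S_min; exists S; split=> //.
  by move=> i ltiS; apply/negP => /S_min; rewrite leqNgt ltiS.
by apply: position_stable => //; exact: S_min.
Qed.

Lemma greedy_decompressor : exists2 E, decompressor E &
  forall c, (forall t v p, 0 < v -> size p = level t + c.+1 -> E p = Some v ->
      exists N, legal c t v N) ->
    exists v : nat -> nat, forall t, legal c t (v t) (v t.+1).
Proof.
have [E E_dec E_pos] := position_decompressor; exists E => // c has_move.
have /choice[T found] : forall t, exists T, position c T t < T.
  elim=> [|t [T found]]; first by exists 2.
  have [p codep] := string_code_surj (slot c t).
  have E_p := E_pos c t T p codep found.
  have [|N moveN] := has_move t _ p (position_gt0 found) _ E_p.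
    by rewrite size_string_code codep trunc_log_slot.
  exists (maxn T N.+1); rewrite [ltnLHS]/= -/(position c (maxn T N.+1) t).
  rewrite (position_stable found (leq_maxl _ _)).
  by apply: find_iota_lt moveN; exact: leq_maxr.
exists (fun t => position c (T t) t) => t; set M := maxn (T t) (T t.+1).
rewrite -(position_stable (found t) (leq_maxl _ _ : _ <= M)).
have stable := position_stable (found t.+1) (leq_maxr _ _ : _ <= M).
rewrite -stable; apply: position_step; rewrite stable.
exact: leq_trans (found _) (leq_maxr _ _).
Qed.

End GreedyPlay.

Section HeavyIntervals.
Variables (f g d : nat -> nat -> nat) (horizon : nat -> nat).

(* With [d k N / 2 ^ N] as a lower bound for [m k], the numbers from [v] to [N]
   have mass at least [2 ^ - (y + 1)] for every pair [(x, y)] whose [x] is [c]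
   plus the length of the string describing [v]. *)
Definition heavy c t v N := (v < N) &&
  all (fun y => approx_pair f g (horizon c) (level t + (2 * c).+1) y ==>
      (2 ^ N <= 2 ^ y.+1 * \sum_(v <= k < N) d k N)) (index_iota 0 (horizon c)).

Lemma computable_heavy :
  computable2 f -> computable2 g -> computable2 d -> computable1 horizon ->
  computable4 (fun c t v N => heavy c t v N).
Proof.
move=> f_comp g_comp d_comp horizon_comp.
have pair_comp := computable_approx_pair f_comp g_comp.
by rewrite /heavy /level; computability.
Qed.

Lemma heavy_lt c t v N : heavy c t v N -> v < N.
Proof. by case/andP. Qed.

End HeavyIntervals.

(** * Selections that depend on their own history *)

Definition bit h i := odd (h %/ 2 ^ i).
Definition popcount h n := \sum_(0 <= i < n) bit h i.

Lemma computable_popcount : computable2 popcount.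
Proof. by apply/computable2P; rewrite /popcount /bit; computability. Qed.

Section Selection.
Variable rule : nat -> nat -> nat -> bool.

(* [rule c s h] decides whether game [c] selects step [s], where [h] is the bit
   mask of the steps that it has selected before. *)
Definition history c s :=
  iteri s (fun i h => if rule c i h then h + 2 ^ i else h) 0.

Definition selected c s := rule c s (history c s).
Definition selection_count c n := \sum_(0 <= i < n) selected c i.

Lemma computable_selected : computable3 (fun c s h => rule c s h) ->
  computable2 (fun c s => selected c s).
Proof.
move=> rule_comp; have history_comp : computable2 history.
  apply/computable2P; rewrite /history; apply: (computable_iteri
    (G := fun i h v => if rule (nth 0 v 0) i h then h + 2 ^ i else h)).
  all: computability.
by apply/computable2P; rewrite /selected; computability.
Qed.

Lemma historyS c s : history c s.+1 = history c s + selected c s * 2 ^ s.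
Proof.
rewrite [LHS]/= -/(history c s) /selected.
by case: (rule c s _); rewrite /= ?mul1n ?addn0.
Qed.

Lemma history_lt c s : history c s < 2 ^ s.
Proof.
elim: s => // s IHs; rewrite historyS expnS mul2n -addnn -addSn leq_add //.
by case: selected; rewrite /= ?mul1n ?mul0n.
Qed.

Lemma bit_history c s i : i < s -> bit (history c s) i = selected c i.
Proof.
rewrite /bit; elim: s => // s IHs; rewrite ltnS leq_eqVlt historyS addnC.
case/orP=> [/eqP->|ltis].
  by rewrite divnMDl ?expn_gt0 // divn_small ?history_lt // addn0 oddb.
rewrite -[in 2 ^ s](subnK (ltnW ltis)) expnD mulnA divnMDl ?expn_gt0 //.
by rewrite oddD IHs // oddM oddX /= subn_eq0 leqNgt ltis /= andbF.
Qed.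

Lemma selection_countS c n :
  selection_count c n.+1 = selection_count c n + selected c n.
Proof. by rewrite /selection_count big_nat_recr. Qed.

Lemma leq_selection_count c : {homo selection_count c : a b / a <= b}.
Proof.
move=> a b le_ab.
by rewrite /selection_count [leqRHS](big_cat_nat _ le_ab) ?leq_addr.
Qed.

Lemma popcount_history c s n :
  n <= s -> popcount (history c s) n = selection_count c n.
Proof.
move=> le_ns; apply: eq_big_nat => i /andP[_ ltin].
by rewrite bit_history // (leq_trans ltin).
Qed.

Lemma nth_selection c s j :
  j < selection_count c s -> exists2 i, selected c i & selection_count c i = j.
Proof.
elim: s => [|s IHs]; first by rewrite /selection_count big_geq.
case: (ltnP j (selection_count c s)) => [/IHs //|le_j].
rewrite selection_countS => lt_j; exists s; last by lia.
by case: selected lt_j => /=; lia.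
Qed.

End Selection.

(** * The game against a prefix-free decompressor *)

Lemma near_all (U : Type) (T : eqType) (F : set_system U) (r : seq T)
    (p : U -> pred T) : Filter F ->
  {in r, forall i, \forall u \near F, p u i} -> \forall u \near F, all (p u) r.
Proof.
move=> F_filter; elim: r => [|i r IHr] near_p; first exact: nearW.
have near_r : \forall u \near F, all (p u) r.
  by apply: IHr => j r_j; apply: near_p; rewrite inE r_j orbT.
by apply: filterS2 (near_p i (mem_head i r)) near_r => u /= ->.
Qed.

Section PrefixGame.
Variables (f g out : nat -> nat -> nat) (horizon : nat -> nat).
Local Notation approx_pair := (approx_pair f g).
Local Notation pair_mass := (pair_mass f g).

(* [out s n = N.+1] means that the program coded by [n] is seen at time [s] to
   output [N], and [h] is the bit mask of the points that carry a weight.  Some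
   program of length at most [y] has output a number beyond which there are
   fewer than [2 ^ (horizon c + 2 * c - x)] weights. *)
Definition covered c s h x y :=
  has (fun n => [&& 0 < out s n, out s n <= s &
      popcount h s * 2 ^ x
        < popcount h (out s n) * 2 ^ x + 2 ^ (horizon c + 2 * c)])
    (index_iota 0 (2 ^ y.+1).-1).

Definition all_covered c s h :=
  all (fun x => all (fun y => approx_pair (horizon c) x y ==> covered c s h x y)
    (index_iota 0 (horizon c))) (index_iota (2 * c).+1 (horizon c)).

Definition game_at s := s - 2 ^ trunc_log 2 s.

Definition place_weight c s h :=
  [&& game_at s == c, popcount h s < 2 ^ horizon c & all_covered c s h].

Local Notation history := (history place_weight).
Local Notation weighted := (selected place_weight).
Local Notation weight_count := (selection_count place_weight).

Lemma computable_game_at : computable1 game_at.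
Proof. by rewrite /game_at; computability. Qed.

Lemma computable_weighted : computable2 f -> computable2 g -> computable2 out ->
  computable1 horizon -> computable2 (fun c s => weighted c s).
Proof.
move=> f_comp g_comp out_comp horizon_comp; apply: computable_selected.
have pair_comp := computable_approx_pair f_comp g_comp.
have popcount_comp := computable_popcount; have game_comp := computable_game_at.
by rewrite /place_weight /all_covered /covered; computability.
Qed.

Lemma all_covered_eventually c (h : nat -> nat) :
  (forall x y, 2 * c < x -> approx_pair (horizon c) x y ->
    \forall s \near \oo, covered c s (h s) x y) ->
  \forall s \near \oo, all_covered c s (h s).
Proof.
move=> covered_near; apply: near_all => x.
rewrite mem_index_iota => /andP[lt_x _]; apply: near_all => y _.
have [pair_xy|_] := boolP (approx_pair (horizon c) x y); last exact: nearW.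
exact: covered_near.
Qed.

Lemma game_at_infinitely_often c s0 : exists2 s, s0 <= s & game_at s = c.
Proof.
have lt_exp := ltn_expl (s0 + c) (isT : 1 < 2).
exists (2 ^ (s0 + c) + c); first by lia.
rewrite /game_at (@trunc_log_eq 2 (s0 + c)) ?addKn // expnS leq_addr /=.
by rewrite mul2n -addnn ltn_add2l (leq_ltn_trans (leq_addl s0 c)).
Qed.

Lemma weightedP c s : weighted c s ->
  [/\ game_at s = c, weight_count c s < 2 ^ horizon c &
    all_covered c s (history c s)].
Proof.
by rewrite /selected /place_weight popcount_history // => /and3P[/eqP].
Qed.

Lemma weight_count_le c n : weight_count c n <= 2 ^ horizon c.
Proof.
elim: n => [|n IHn]; first by rewrite /selection_count big_geq.
rewrite selection_countS.
have [/weightedP[_ lt_count _]|_] := boolP (weighted c n).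
  by rewrite addn1.
by rewrite addn0.
Qed.

Lemma weight_count_full c :
  (\forall s \near \oo, all_covered c s (history c s)) ->
  exists s, weight_count c s = 2 ^ horizon c.
Proof.
move=> [s0 _ covered_after].
suff /(_ _ (leqnn _))[s le_s] :
    forall k, k <= 2 ^ horizon c -> exists s, k <= weight_count c s.
  by exists s; apply/eqP; rewrite eqn_leq weight_count_le.
elim=> [|k IHk] lt_k; first by exists 0.
have [s1 le_s1] := IHk (ltnW lt_k).
have [s le_s game_s] := game_at_infinitely_often c (maxn s0 s1).
have [le_s0 le_s1s] : s0 <= s /\ s1 <= s by apply/andP; rewrite -geq_max.
case: (ltnP k (weight_count c s)) => [lt_ks|le_ks]; first by exists s.
exists s.+1; rewrite selection_countS; suff -> : weighted c s.
  by rewrite addn1 ltnS (leq_trans le_s1) // leq_selection_count.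
rewrite /selected /place_weight game_s eqxx popcount_history //.
by rewrite (leq_ltn_trans le_ks) //=; exact: covered_after.
Qed.

Variable P : seq bool -> option nat.
Hypothesis out_sound : forall s n N, out s n = N.+1 ->
  exists2 p, string_code p = n & P p = Some N.

Lemma covering_program c s x y j : j < weight_count c s ->
  2 * c < x < horizon c -> y < horizon c -> approx_pair (horizon c) x y ->
  exists p N, [/\ size p <= y, P p = Some N, weight_count c N.+1 <= j &
    j * 2 ^ x < weight_count c N.+1 * 2 ^ x + 2 ^ (horizon c + 2 * c)].
Proof.
move=> /nth_selection[i /weightedP[_ _ /allP all_cov] count_i].
move=> x_range y_lt pair_xy.
have x_in : x \in index_iota (2 * c).+1 (horizon c) by rewrite mem_index_iota.
have y_in : y \in index_iota 0 (horizon c) by rewrite mem_index_iota.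
have /allP/(_ y y_in) := all_cov x x_in; rewrite pair_xy => /hasP[n].
rewrite mem_index_iota /= => code_lt.
case outE: (out i n) => [//|N] /and3P[_ le_Ni].
rewrite !popcount_history // count_i.
have [p codep Pp] := out_sound outE => lt_j; exists p, N; split=> //.
  have /andP[size_le _] := string_code_bounds p; rewrite codep in size_le.
  by rewrite -ltnS -(@ltn_exp2l 2) //; lia.
by rewrite -count_i leq_selection_count.
Qed.

Lemma many_programs c s x y : weight_count c s = 2 ^ horizon c ->
  2 * c < x < horizon c -> y < horizon c -> approx_pair (horizon c) x y ->
  2 ^ x <= 2 ^ (2 * c).+1 *
    #|[pred p : (horizon c).-bseq bool | P p & size p <= y]|.
Proof.
set K := horizon c => full x_range y_lt pair_xy.
pose l := 2 ^ (K + 2 * c - x); pose b := (2 ^ (x - 2 * c)).-1.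
have l_gt0 : 0 < l by rewrite expn_gt0.
have full_l : 2 ^ K = 2 ^ (x - 2 * c) * l by rewrite -expnD; congr expn; lia.
have tail_l : 2 ^ (K + 2 * c) = l * 2 ^ x by rewrite -expnD; congr expn; lia.
have /choice[p p_cover] : forall i : 'I_b, exists p : K.-bseq bool,
    [/\ size p <= y, P p & (weight_count c (odflt 0 (P p)).+1).-1 %/ l = i].
  move=> i; have [|p [N [le_py Pp le_w lt_w]]] :=
      @covering_program c s x y (i.+1 * l) _ x_range y_lt pair_xy.
    rewrite full -/K full_l ltn_mul2r l_gt0 /=.
    by have := ltn_ord i; rewrite /b; lia.
  have le_pK : size p <= K by exact: leq_trans le_py (ltnW y_lt).
  exists (Bseq le_pK); split=> //=; first by rewrite Pp.
  move: lt_w; rewrite Pp tail_l -mulnDl ltn_mul2r expn_gt0 /= => lt_w.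
  apply/eqP; rewrite eqn_leq leq_divRL // -ltnS ltn_divLR //.
  move: le_w lt_w; rewrite !mulSn.
  by move: (i * l) (weight_count c _) => *; lia.
have p_inj : injective p.
  move=> i j eq_p; apply: val_inj; have [_ _ /= <-] := p_cover i.
  by have [_ _ <-] := p_cover j; rewrite eq_p.
have le_b : b <= #|[pred q : K.-bseq bool | P q & size q <= y]|.
  rewrite -(card_ord b) -(card_codom p_inj).
  apply/subset_leq_card/fintype.subsetP => q.
  by case/codomP => i ->; have [le_py Pp _] := p_cover i; rewrite inE Pp.
apply: leq_trans (leq_mul (leqnn _) le_b); rewrite /b.
have -> : x - 2 * c = (x - (2 * c).+1).+1 by lia.
have -> : 2 ^ x = 2 ^ (2 * c).+1 * 2 ^ (x - (2 * c).+1).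
  by rewrite -expnD; congr expn; lia.
rewrite leq_mul2l -[_ <= _.-1]ltnS prednK ?expn_gt0 //.
by rewrite ltn_exp2l // ltnSn orbT.
Qed.

Lemma pair_mass_le_full c s :
  prefix_free P -> weight_count c s = 2 ^ horizon c ->
  pair_mass (2 * c) (horizon c) <= 2 ^ (horizon c + 2 * c).+3.
Proof.
move=> P_pf full; set K := horizon c.
pose programs y := #|[pred p : K.-bseq bool | P p & size p <= y]|.
have kraftP : \sum_(y < K) programs y * 2 ^ (K - y) <= 2 ^ K.+1.
  apply: (kraft_upto K (A := fun p => P p)) => p q; rewrite !unfold_in => Pp Pq.
  by apply: P_pf; [case: (P p) Pp|case: (P q) Pq].
have -> : 2 ^ (K + 2 * c).+3 = 2 ^ (2 * c).+2 * 2 ^ K.+1.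
  by rewrite -expnD; congr expn; lia.
apply: leq_trans (leq_mul (leqnn _) kraftP); rewrite pair_massE.
rewrite (exchange_big_dep xpredT) //= big_distrr /=; apply: leq_sum => y _.
rewrite expnS -mulnA.
apply: sum_distinct_exp2 => [a b _ _ /= eq_e|x /and3P[lt_x _ pair_xy]].
  by apply: val_inj => /=; have := ltn_ord y; lia.
rewrite mulnA [leqLHS](_ : _ = 2 ^ x * 2 ^ (K - y)); last first.
  by rewrite -expnD; congr expn; have := ltn_ord y; lia.
by rewrite leq_mul2r (many_programs full) ?orbT // lt_x ltn_ord.
Qed.

End PrefixGame.

Local Open Scope ring_scope.

(** * Series and semicomputable limits *)

Lemma lower_semicomputableP x : lower_semicomputable x ->
  exists f, [/\ computable2 f, forall n k, (f n k <= x n)%N &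
    forall n, \forall k \near \oo, f n k = x n].
Proof.
move=> [f [f_comp f_nd f_cvg]].
have f_x n : \forall k \near \oo, f n k = x n.
  exact: (f_cvg n _ (discrete_set1 (x n))).
exists f; split=> // n k.
have [k' [<- le_kk']] := filter_ex (filterI (f_x n) (nbhs_infty_ge k)).
exact: f_nd.
Qed.

Lemma upper_semicomputableP y : upper_semicomputable y ->
  exists g, [/\ computable2 g, forall n k, (y n <= g n k)%N &
    forall n, \forall k \near \oo, g n k = y n].
Proof.
move=> [g [g_comp g_ni g_cvg]].
have g_y n : \forall k \near \oo, g n k = y n.
  exact: (g_cvg n _ (discrete_set1 (y n))).
exists g; split=> // n k.
have [k' [<- le_kk']] := filter_ex (filterI (g_y n) (nbhs_infty_ge k)).
exact: g_ni.
Qed.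

Section NonnegativeSeries.
Variables (R : realType) (u : nat -> R).
Hypothesis u_ge0 : forall k, 0 <= u k.

Lemma lt_nneseries_partial a (r : R) : (r%:E < \sum_(a <= k <oo) (u k)%:E)%E ->
  exists n, r < \sum_(a <= k < n) u k.
Proof.
apply: contraPP => /forallNP partial_le; apply/negP; rewrite -leNgt.
apply: lime_le; first by apply: is_cvg_nneseries => k _ _; rewrite lee_fin.
by apply: nearW => n; rewrite sumEFin lee_fin leNgt; apply/negP/partial_le.
Qed.

Lemma nneseries_partial_lt a b (r : R) :
  (\sum_(a <= k <oo) (u k)%:E < r%:E)%E -> \sum_(a <= k < b) u k < r.
Proof.
rewrite -lte_fin -sumEFin; apply: le_lt_trans.
by apply: nneseries_lim_ge => k _ _; rewrite lee_fin.
Qed.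

Lemma le_nneseries_tail a b : (a <= b)%N ->
  (\sum_(b <= k <oo) (u k)%:E <= \sum_(a <= k <oo) (u k)%:E)%E.
Proof.
move=> /subnKC <-.
rewrite [leRHS](nneseries_split _ (b - a)) => [|k _]; last by rewrite lee_fin.
by rewrite leeDr // sume_ge0 // => k _; rewrite lee_fin.
Qed.

Hypothesis u_cvg : cvgn (series u).

Lemma partial_sum_le_lim n : \sum_(0 <= k < n) u k <= limn (series u).
Proof.
apply: (nondecreasing_cvgn_le _ u_cvg); apply/nondecreasing_seqP => k.
by rewrite /series /= big_nat_recr //= lerDl.
Qed.

Lemma is_BP'_exists n : exists M, is_BP' u n M.
Proof.
have sum_fin : (\sum_(0 <= k <oo) (u k)%:E < +oo)%E.
  rewrite (_ : (fun _ => _) = EFin \o series u); last first.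
    by apply/funext => k /=; rewrite sumEFin.
  by rewrite EFin_lim // ltry.
have bound_gt0 : (0 < (2 ^- n)%:E :> \bar R)%E.
  by rewrite lte_fin invr_gt0 exprn_gt0.
have tail_cvg : (fun a => \sum_(a <= k <oo) (u k)%:E)%E @ \oo --> 0%E.
  by apply: nneseries_tail_cvg => // k _; rewrite lee_fin.
have tail_lt := tail_cvg _ (open_ereal_lt' bound_gt0).
have [N [N_gt0 small]] := filter_ex (filterI (nbhs_infty_gt 0) tail_lt).
have small_ex : exists N,
    `[< (\sum_(N.+1 <= k <oo) (u k)%:E < (2 ^- n)%:E :> \bar R)%E >].
  by exists N.-1; apply/asboolP; rewrite prednK.
case: (ex_minnP small_ex) => M /asboolP smallM M_min; exists M; split=> //.
by move=> l small_l; apply: M_min; apply/asboolP.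
Qed.

End NonnegativeSeries.

Lemma diverging_scaled_sums (R : realType) (x y : nat -> nat) :
  (forall n, (x n <= y n)%N) ->
  (\sum_(0 <= n <oo) (2 ^ ((x n)%:Z - (y n)%:Z) : R)%:E = +oo)%E ->
  forall A, exists M, \forall K \near \oo,
    (A * 2 ^ K <= \sum_(n < M) 2 ^ (K + x n - y n))%N.
Proof.
move=> x_le_y diverges A.
pose u n : R := 2 ^ ((x n)%:Z - (y n)%:Z).
have [||M lt_A] := @lt_nneseries_partial R u _ 0 A%:R.
- by move=> n; rewrite exprz_ge0.
- by rewrite diverges ltry.
exists M; near=> K.
have y_le : forall n : 'I_M, (y n <= K)%N.
  by near: K; apply: filter_forall => n; exact: nbhs_infty_ge.
have termE (n : 'I_M) : (2 ^ (K + x n - y n))%:R = 2 ^+ K * u n.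
  rewrite /u natrX !exprnP -expfzDr //; congr (_ ^ _).
  by have := x_le_y n; have := y_le n; lia.
rewrite -(ler_nat R) natrM natr_sum natrX mulrC.
rewrite (eq_bigr _ (fun n _ => termE n)).
rewrite -big_distrr /= ler_wpM2l ?exprn_ge0 // ltW //.
by move: lt_A; rewrite big_mkord.
Unshelve. all: by end_near. Qed.

Lemma near_exp2_ge (R : realType) (r : R) : \forall n \near \oo, r <= 2 ^+ n.
Proof.
apply: filterS (nbhs_infty_ger r) => n /le_trans-> //.
by rewrite -natrX ler_nat ltnW // ltn_expl.
Qed.

Lemma ler_exp2V (R : realType) a b : (2 ^- a <= 2 ^- b :> R) = (b <= a)%N.
Proof. by rewrite lef_pV2 ?posrE ?exprn_gt0 // ler_eXn2l ?ltr1n. Qed.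

Lemma dyadic_approximation (R : realType) (m : nat -> R) :
  lower_semicomputable_real m -> (forall k, 0 <= m k) ->
  exists d, [/\ computable2 d, forall k N, (d k N)%:R <= 2 ^+ N * m k &
    forall k, (d k N)%:R / 2 ^+ N @[N --> \oo] --> m k].
Proof.
move=> [q [[a [b [c [a_comp b_comp c_comp qE]]]] q_nd q_cvg]] m_ge0.
pose r k N : R := (a k N - b k N)%N%:R / (c k N).+1%:R.
have q_le k N : q k N <= r k N.
  by rewrite qE ler_pM2r ?invr_gt0 // lerBlDr -natrD ler_nat; lia.
have r_le k N : r k N <= m k.
  rewrite /r; case: (leqP (b k N) (a k N)) => [le_ba|/ltnW/eqP ->]; last first.
    by rewrite mul0r.
  rewrite natrB // -qE -(cvg_lim _ (q_cvg k)) //.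
  by apply: nondecreasing_cvgn_le => [i j /q_nd//|]; exact: cvgP (q_cvg k).
pose d k N := ((a k N - b k N) * 2 ^ N %/ (c k N).+1)%N.
have rE k N : 2 ^+ N * r k N = ((a k N - b k N) * 2 ^ N)%N%:R / (c k N).+1%:R.
  by rewrite /r natrM natrX mulrA [2 ^+ N * _]mulrC.
have d_le k N : (d k N)%:R <= 2 ^+ N * r k N.
  by rewrite rE ler_pdivlMr // -natrM ler_nat leq_divM.
have d_ge k N : 2 ^+ N * r k N <= (d k N)%:R + 1.
  by rewrite rE ler_pdivrMr // natr1 -natrM ler_nat ltnW // ltn_ceil.
exists d; split=> [|k N|k].
- by apply/computable2P; rewrite /d; computability.
- by apply: le_trans (d_le k N) _; rewrite ler_wpM2l ?exprn_ge0.
- have half_cvg : (2^-1 : R) ^+ N @[N --> \oo] --> 0.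
    by apply: cvg_expr; rewrite ger0_norm ?invr_ge0 // invf_lt1 ?ltr1n.
  have lower_cvg : q k N - 2^-1 ^+ N @[N --> \oo] --> m k.
    by rewrite -[m k]subr0; exact: cvgB.
  apply: (squeeze_cvgr _ lower_cvg (cvg_cst (m k))); apply: nearW => N /=.
  have two_gt0 : 0 < 2 ^+ N :> R by rewrite exprn_gt0.
  rewrite ler_pdivlMr // ler_pdivrMr // [m k * _]mulrC; apply/andP; split.
    rewrite mulrBl exprVn mulVf ?gt_eqF // lerBlDr; apply: le_trans (d_ge k N).
    by rewrite mulrC ler_pM2l.
  by apply: le_trans (d_le k N) _; rewrite ler_pM2l.
Qed.

Lemma dyadic_tail_eventually_ge (R : realType) (m : nat -> R)
    (d : nat -> nat -> nat) v y :
  (forall k, 0 <= m k) ->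
  (forall k, (d k N)%:R / 2 ^+ N @[N --> \oo] --> m k) ->
  ((2 ^- y)%:E <= \sum_(v <= k <oo) (m k)%:E :> \bar R)%E ->
  \forall N \near \oo, (2 ^ N <= 2 ^ y.+1 * \sum_(v <= k < N) d k N)%N.
Proof.
move=> m_ge0 d_cvg tail_mass_ge.
have [||n partial_gt] := @lt_nneseries_partial R m _ v (2 ^- y.+1) => //.
  by apply: lt_le_trans tail_mass_ge; rewrite lte_fin ltNge ler_exp2V ltnn.
have partial_cvg : \sum_(v <= k < n) (d k N)%:R / 2 ^+ N @[N --> \oo] -->
    \sum_(v <= k < n) m k.
  by apply: cvg_big => [|k _]; [exact: add_continuous|exact: d_cvg].
near=> N.
have le_nN : (n <= N)%N by near: N; exact: nbhs_infty_ge.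
rewrite -(ler_nat R) natrM !natrX -ler_pdivrMl ?exprn_gt0 // mulrC.
rewrite -ler_pdivlMl ?exprn_gt0 // mulrC.
apply: (@le_trans _ _ (\sum_(v <= k < n) (d k N)%:R / 2 ^+ N)).
  by apply: ltW; near: N; exact: cvgr_gt partial_cvg _ partial_gt.
rewrite -big_distrl /= ler_wpM2r ?invr_ge0 ?exprn_ge0 // -natr_sum ler_nat.
rewrite !(big_nat_widenl v 0) //= [leqRHS](big_cat_nat _ le_nN) //=.
exact: leq_addr.
Unshelve. all: by end_near. Qed.

Lemma sum_distinct_exp2R (R : realType) (I : finType) (Q : pred I)
    (e : I -> nat) (a : R) :
  {in Q &, injective e} -> 0 <= a -> (forall i, Q i -> 2 ^+ e i <= a) ->
  (\sum_(i | Q i) 2 ^ e i)%:R <= 2 * a.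
Proof.
move=> e_inj a_ge0 e_le; apply: (@le_trans _ _ (2 * Num.truncn a)%N%:R).
  rewrite ler_nat; apply: sum_distinct_exp2 => // i Qi.
  by rewrite truncn_ge_nat // natrX e_le.
by rewrite natrM ler_wpM2l // truncn_le.
Qed.

(** * The game against the a priori probability *)

Lemma mul_step_le_telescope (R : realType) (u : nat -> R) a b (r : R) :
  (a <= b)%N -> (forall i, (a <= i < b)%N -> r <= u i.+1 - u i) ->
  (b - a)%N%:R * r <= u b - u a.
Proof.
move=> le_ab step_ge; rewrite -telescope_sumr // mulr_natl -sumr_const_nat.
exact: ler_sum_nat.
Qed.

Lemma level_block e t : ((2 ^ e).-1 <= t < (2 ^ e.+1).-1)%N -> level t = e.
Proof.
have := expn_gt0 2 e; have := expn_gt0 2 e.+1 => /= pow_gt0 pow_gt0' t_range.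
by apply: trunc_log_eq => //; lia.
Qed.

Section Gain.
Variables (R : realType) (f g : nat -> nat -> nat) (K a : nat).
Variables (mass : nat -> R) (S : R).
Hypotheses (mass_ge0 : 0 <= mass 0) (mass_le : forall t, mass t <= S).
Hypothesis mass_nd : forall t, mass t <= mass t.+1.
Hypothesis mass_step : forall t y, (y < K)%N ->
  approx_pair f g K (level t + a.+1)%N y -> 2 ^- y.+1 <= mass t.+1 - mass t.

Let gain e := mass (2 ^ e.+1).-1 - mass (2 ^ e).-1.

Let gain_ge e (r : R) : (forall t, level t = e -> r <= mass t.+1 - mass t) ->
  2 ^+ e * r <= gain e.
Proof.
move=> step_ge; rewrite -natrX.
have -> : (2 ^ e = (2 ^ e.+1).-1 - (2 ^ e).-1)%N.
  by rewrite expnS; have := expn_gt0 2 e; lia.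
apply: mul_step_le_telescope; first by rewrite expnS; lia.
by move=> t /level_block; exact: step_ge.
Qed.

Let row_mass_le e :
  (\sum_(0 <= y < K | (e + a.+1 <= y)%N && approx_pair f g K (e + a.+1)%N y)
     2 ^ (K + (e + a.+1) - y))%:R <= 2 ^+ (K + a).+3 * gain e.
Proof.
rewrite big_mkord exprS -mulrA; apply: sum_distinct_exp2R.
- move=> y z _ _ /= eq_e; apply: val_inj => /=.
  by have := ltn_ord y; have := ltn_ord z; lia.
- rewrite mulr_ge0 ?exprn_ge0 // -[0](mulr0 (2 ^+ e)).
  by apply: gain_ge => t _; rewrite subr_ge0.
- move=> y /andP[_ pair_y]; rewrite -ler_pdivrMl ?exprn_gt0 //.
  apply: le_trans (gain_ge (r := 2 ^- y.+1) _); last first.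
    by move=> t level_t; apply: mass_step => //; rewrite level_t.
  rewrite mulrC ler_pdivrMr ?exprn_gt0 // mulrAC ler_pdivlMr ?exprn_gt0 //.
  rewrite -!exprD.
  by apply: ler_weXn2l; [rewrite ler1n|have := ltn_ord y; lia].
Qed.

Lemma pair_mass_le_gain : (pair_mass f g a K)%:R <= 2 ^+ (K + a).+3 * S.
Proof.
rewrite /pair_mass -[a.+1]add0n big_addn natr_sum.
apply: le_trans (ler_sum _ (fun e _ => row_mass_le e)) _.
rewrite -big_distrr /= ler_wpM2l ?exprn_ge0 // /gain.
rewrite (telescope_sumr (fun e => mass (2 ^ e).-1)) // lerBlDr.
by apply: le_trans (mass_le _) _; rewrite lerDl.
Qed.

End Gain.

Lemma pair_mass_le_heavy_chain (R : realType) (m : nat -> R)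
    (f g d : nat -> nat -> nat) (horizon : nat -> nat) c (S : R)
    (v : nat -> nat) :
  (forall k, 0 <= m k) -> (forall n, \sum_(0 <= k < n) m k <= S) ->
  (forall k N, (d k N)%:R <= 2 ^+ N * m k) ->
  (forall t, heavy f g d horizon c t (v t) (v t.+1)) ->
  (pair_mass f g (2 * c)%N (horizon c))%:R <= 2 ^+ (horizon c + 2 * c).+3 * S.
Proof.
move=> m_ge0 partial_le d_le chain.
pose mass t := \sum_(0 <= k < v t) m k.
have massB t : mass t.+1 - mass t = \sum_(v t <= k < v t.+1) m k.
  have le_v := ltnW (heavy_lt (chain t)).
  by rewrite /mass (big_cat_nat _ le_v) //= addrAC subrr add0r.
apply: (@pair_mass_le_gain _ _ _ _ _ mass) => [|t|t|t y y_lt pair_y].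
- exact: sumr_ge0.
- exact: partial_le.
- by rewrite -subr_ge0 massB sumr_ge0.
have /andP[_ /allP/(_ y)] := chain t.
rewrite mem_index_iota pair_y => /(_ y_lt) /=.
rewrite -(ler_nat R) natrM !natrX => heavy_y.
rewrite massB -div1r ler_pdivrMr ?exprn_gt0 //.
rewrite -(@ler_pM2l _ (2 ^+ v t.+1)) ?exprn_gt0 // mulr1.
apply: le_trans heavy_y _.
rewrite mulrA mulrC ler_wpM2r ?exprn_ge0 // natr_sum big_distrr /=.
exact: ler_sum.
Qed.

Section BGap.
Variables (R : realType) (m : nat -> R) (D : seq bool -> option nat).
Variables (x y : nat -> nat) (f g : nat -> nat -> nat) (horizon : nat -> nat).
Hypotheses (D_opt : optimal_decompressor D) (m_summable : summable_lsc m).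
Hypotheses (f_comp : computable2 f) (g_comp : computable2 g).
Hypothesis horizon_comp : computable1 horizon.
Hypothesis f_le : forall n k, (f n k <= x n)%N.
Hypothesis g_ge : forall n k, (y n <= g n k)%N.
Hypothesis horizon_rich : forall c, rich f g (horizon c) c.

Let m_ge0 k : 0 <= m k. Proof. by case: m_summable. Qed.
Let m_cvg : cvgn (series m). Proof. by case: m_summable. Qed.

Let no_gap :=
  ~ exists n b b', [/\ is_B D (x n) b, is_BP' m (y n) b' & (b' < b)%N].

Let tail_mass_ge n q v :
  no_gap -> (0 < v)%N -> (size q <= x n)%N -> D q = Some v ->
  ((2 ^- y n)%:E <= \sum_(v <= k <oo) (m k)%:E :> \bar R)%E.
Proof.
move=> gapless v_gt0 le_qx Dq.
have [b B_b le_vb] := is_B_exists le_qx Dq.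
have [b' BP_b'] := is_BP'_exists m_ge0 m_cvg (y n).
rewrite leNgt; apply/negP => tail_lt; apply: gapless; exists n, b, b'.
split=> //; apply: leq_trans le_vb; rewrite -(prednK v_gt0) ltnS.
by have [_] := BP_b'; apply; rewrite /= prednK.
Qed.

Let heavy_eventually d c t v p : no_gap ->
  (forall k, (d k N)%:R / 2 ^+ N @[N --> \oo] --> m k) ->
  (0 < v)%N -> (size p <= level t + (2 * c).+1)%N -> D p = Some v ->
  \forall N \near \oo, heavy f g d horizon c t v N.
Proof.
move=> gapless d_cvg v_gt0 le_p Dp; set a := (level t + (2 * c).+1)%N in le_p *.
near=> N; apply/andP; split; first by near: N; exact: nbhs_infty_gt.
near: N; apply: near_all => b _.
have [/hasP[n _ /andP[/eqP fn /eqP gn]]|_] :=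
  boolP (approx_pair f g (horizon c) a b); last exact: nearW.
have le_px : (size p <= x n)%N by rewrite (leq_trans le_p) // -fn.
have tail_b : ((2 ^- b)%:E <= \sum_(v <= k <oo) (m k)%:E :> \bar R)%E.
  apply: le_trans (tail_mass_ge gapless v_gt0 le_px Dp).
  by rewrite lee_fin ler_exp2V -gn.
exact: (dyadic_tail_eventually_ge m_ge0 d_cvg tail_b).
Unshelve. all: by end_near. Qed.

Lemma B_gt_BP' :
  exists n b b', [/\ is_B D (x n) b, is_BP' m (y n) b' & (b' < b)%N].
Proof.
apply: contrapT => gapless.
have [m_lsc _ _] := m_summable.
have [d [d_comp d_le d_cvg]] := dyadic_approximation m_lsc m_ge0.
have heavy_comp := computable_heavy f_comp g_comp d_comp horizon_comp.
have [E E_dec E_chain] :=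
  greedy_decompressor heavy_comp (@heavy_lt f g d horizon).
have [overhead D_le] := not_worseP (D_opt.2 E E_dec).
have [c [S_le overhead_le]] :=
  filter_ex (filterI (near_exp2_ge (limn (series m))) (nbhs_infty_ge overhead)).
have [t v p v_gt0 size_p Ep|v chain] := E_chain c.
  have [q le_q Dq] := D_le _ _ Ep.
  rewrite size_p in le_q.
  have le_q2c : (size q <= level t + (2 * c).+1)%N by lia.
  have [N] := filter_ex (heavy_eventually gapless d_cvg v_gt0 le_q2c Dq).
  by exists N.
have := horizon_rich c; rewrite /rich ltnNge => /negP; apply.
have -> : ((horizon c + 3 * c).+3 = (horizon c + 2 * c).+3 + c)%N by lia.
rewrite -(ler_nat R) natrX exprD.
apply: pair_mass_le_heavy_chain m_ge0 _ d_le chain => n.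
exact: le_trans (partial_sum_le_lim m_ge0 m_cvg n) S_le.
Qed.

End BGap.

(** * The weights of the game against a prefix-free decompressor *)

Lemma sum_exp2V (R : realType) n : \sum_(c < n) 2 ^- c.+1 = 1 - 2 ^- n :> R.
Proof.
elim: n => [|n IHn]; first by rewrite big_ord0 expr0 invr1 subrr.
by rewrite big_ord_recr /= IHn exprS invfM; lra.
Qed.

Section Weights.
Variables (R : realType) (f g out : nat -> nat -> nat) (horizon : nat -> nat).
Local Notation weighted := (selected (place_weight f g out horizon)).
Local Notation weight_count := (selection_count (place_weight f g out horizon)).

Definition weight s : R :=
  (weighted (game_at s) s)%:R / 2 ^+ (horizon (game_at s) + (game_at s).+1).

Lemma weight_ge0 s : 0 <= weight s.
Proof. by rewrite divr_ge0 // exprn_ge0. Qed.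

Lemma weighted_le_weight c s :
  (weighted c s)%:R / 2 ^+ (horizon c + c.+1) <= weight s.
Proof.
have [weighted_s|_] := boolP (weighted c s); last by rewrite mul0r weight_ge0.
by rewrite /weight; have [-> _ _] := weightedP weighted_s; rewrite weighted_s.
Qed.

Lemma sum_weight_le1 n : \sum_(0 <= s < n) weight s <= 1.
Proof.
rewrite big_mkord; apply: (@le_trans _ _
  (\sum_(s < n) \sum_(c < n) (weighted c s)%:R / 2 ^+ (horizon c + c.+1))).
  apply: ler_sum => s _.
  have game_lt : (game_at s < n)%N.
    exact: leq_ltn_trans (leq_subr _ _) (ltn_ord s).
  rewrite (bigD1 (Ordinal game_lt)) //= lerDl; apply: sumr_ge0 => c _.
  by rewrite divr_ge0 // exprn_ge0.
rewrite exchange_big /=.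
apply: (@le_trans _ _ (\sum_(c < n) 2 ^- c.+1)); last first.
  by rewrite sum_exp2V gerBl invr_ge0 exprn_ge0.
apply: ler_sum => c _; rewrite -big_distrl /= ler_pdivrMr ?exprn_gt0 //.
rewrite exprD mulrCA mulVf ?expf_neq0 // mulr1 -natr_sum -natrX ler_nat.
rewrite -(big_mkord xpredT (fun s => weighted c s : nat)).
exact: weight_count_le.
Qed.

Lemma weight_count_le_sum_weight c a b : (a <= b)%N ->
  (weight_count c b)%:R - (weight_count c a)%:R
    <= 2 ^+ (horizon c + c.+1) * \sum_(a <= s < b) weight s.
Proof.
move=> le_ab; rewrite /selection_count (big_cat_nat _ le_ab) //= natrD.
rewrite addrAC subrr add0r natr_sum big_distrr /=; apply: ler_sum => s _.
by rewrite -ler_pdivrMl ?exprn_gt0 // mulrC weighted_le_weight.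
Qed.

Hypotheses (f_comp : computable2 f) (g_comp : computable2 g).
Hypotheses (out_comp : computable2 out) (horizon_comp : computable1 horizon).

Lemma weight_summable : summable_lsc weight.
Proof.
split; [|exact: weight_ge0|]; last first.
  apply: nondecreasing_is_cvgn.
    apply/nondecreasing_seqP => n.
    by rewrite /series /= big_nat_recr //= lerDl weight_ge0.
  by exists 1 => _ [n _ <-]; exact: sum_weight_le1.
exists (fun s _ => weight s); split=> [||s]; [|by []|exact: cvg_cst].
have weighted_comp := computable_weighted f_comp g_comp out_comp horizon_comp.
have game_comp := computable_game_at.
exists (fun s _ => weighted (game_at s) s : nat), (fun _ _ => 0%N),
  (fun s _ => (2 ^ (horizon (game_at s) + (game_at s).+1)).-1).
split; try by apply/computable2P; computability.
by move=> s _; rewrite subr0 prednK ?expn_gt0 // natrX.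
Qed.

End Weights.

Section Covering.
Variables (R : realType) (m : nat -> R) (P : seq bool -> option nat).
Variables (f g out : nat -> nat -> nat) (horizon : nat -> nat).
Variables (C : R) (c : nat).
Hypothesis m_ge0 : forall k, 0 <= m k.
Hypothesis out_complete : forall p N, P p = Some N ->
  \forall s \near \oo, out s (string_code p) = N.+1.
Hypothesis weight_le : forall k, weight R f g out horizon k <= C * m k.
Hypotheses (C_gt0 : 0 < C) (C_le : 2 * C <= 2 ^+ c).

Local Notation history := (history (place_weight f g out horizon)).
Local Notation weight_count := (selection_count (place_weight f g out horizon)).

Lemma few_weights_after N a s : (N < s)%N ->
  (\sum_(N.+1 <= k <oo) (m k)%:E < (2 ^- a)%:E :> \bar R)%E ->
  (weight_count c s * 2 ^ a
    < weight_count c N.+1 * 2 ^ a + 2 ^ (horizon c + 2 * c))%N.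
Proof.
move=> lt_Ns /(nneseries_partial_lt m_ge0 s) tail_lt.
rewrite -(ltr_nat R) natrD !natrM !natrX -ltrBlDl -mulrBl.
rewrite -ltr_pdivlMr ?exprn_gt0 //.
apply: le_lt_trans (weight_count_le_sum_weight R f g out horizon c lt_Ns) _.
rewrite -ltr_pdivlMl ?exprn_gt0 //.
apply: (@le_lt_trans _ _ (C * \sum_(N.+1 <= k < s) m k)).
  by rewrite big_distrr /=; apply: ler_sum.
rewrite -ltr_pdivlMl //; apply: lt_le_trans tail_lt _.
have -> : C^-1 *
    (2 ^- (horizon c + c.+1) * (2 ^+ (horizon c + 2 * c) / 2 ^+ a)) =
    2 ^+ c / (2 * C) * 2 ^- a.
  rewrite mul2n -addnn !exprD exprS; field.
  by rewrite !expf_neq0 // gt_eqF.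
rewrite ler_peMl ?invr_ge0 ?exprn_ge0 // ler_pdivlMr ?mul1r //.
by rewrite mulr_gt0.
Qed.

Lemma covered_eventually p N a b : P p = Some N -> (size p <= b)%N ->
  (\sum_(N.+1 <= k <oo) (m k)%:E < (2 ^- a)%:E :> \bar R)%E ->
  \forall s \near \oo, covered out horizon c s (history c s) a b.
Proof.
move=> Pp le_pb tail_lt; near=> s; apply/hasP; exists (string_code p).
  have /andP[_ code_lt] := string_code_bounds p.
  rewrite mem_index_iota /= -ltnS prednK ?expn_gt0 //.
  by apply: leq_trans code_lt _; rewrite leq_exp2l // ltnS.
have lt_Ns : (N < s)%N by near: s; exact: nbhs_infty_gt.
have -> : out s (string_code p) = N.+1 by near: s; exact: out_complete.
by rewrite !popcount_history // lt_Ns few_weights_after.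
Unshelve. all: by end_near. Qed.

End Covering.

Section BPGap.
Variables (R : realType) (m : nat -> R) (P : seq bool -> option nat).
Variables (x y : nat -> nat) (f g : nat -> nat -> nat) (horizon : nat -> nat).
Hypothesis P_opt : optimal_prefix_decompressor P.
Hypothesis m_apriori : apriori_probability m.
Hypotheses (f_comp : computable2 f) (g_comp : computable2 g).
Hypothesis horizon_comp : computable1 horizon.
Hypothesis x_le_y : forall n, (x n <= y n)%N.
Hypothesis f_le : forall n k, (f n k <= x n)%N.
Hypothesis g_ge : forall n k, (y n <= g n k)%N.
Hypothesis horizon_rich : forall c, rich f g (horizon c) c.

Let m_ge0 k : 0 <= m k. Proof. by case: m_apriori => -[]. Qed.
Let m_cvg : cvgn (series m). Proof. by case: m_apriori => -[]. Qed.

Let no_gap :=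
  ~ exists n b' b, [/\ is_BP' m (x n) b', is_B P (y n) b & (b < b')%N].

Let light_program n q M : no_gap -> P q = Some M -> (size q <= y n)%N ->
  exists p N, [/\ (size p <= y n)%N, P p = Some N &
    (\sum_(N.+1 <= k <oo) (m k)%:E < (2 ^- x n)%:E :> \bar R)%E].
Proof.
move=> gapless Pq le_qy.
have [N B_N _] := is_B_exists le_qy Pq.
have [b' BP_b'] := is_BP'_exists m_ge0 m_cvg (x n).
have [/complexity_leP[p le_py Pp] _] := B_N; exists p, N; split=> //.
have le_b'N : (b' <= N)%N.
  by rewrite leqNgt; apply/negP => lt_N; apply: gapless; exists n, b', N.
have [small_tail _] := BP_b'; apply: le_lt_trans small_tail.
exact: le_nneseries_tail.
Qed.

Lemma BP'_gt_BP :
  exists n b' b, [/\ is_BP' m (x n) b', is_B P (y n) b & (b < b')%N].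
Proof.
apply: contrapT => gapless.
have [out out_comp [out_sound out_complete]] := decompressor_run P_opt.1.1.
have [q [M Pq]] := optimal_prefix_has_program P_opt.
have [C [C_gt0 weight_le]] :=
  m_apriori.2 _ (weight_summable R f_comp g_comp out_comp horizon_comp).
have [c [C_le size_q]] :=
  filter_ex (filterI (near_exp2_ge (2 * C)) (nbhs_infty_ge (size q))).
have [|s full] := @weight_count_full f g out horizon c; last first.
  have := horizon_rich c; rewrite /rich ltnNge => /negP; apply.
  apply: leq_trans (pair_mass_le_full out_sound P_opt.1.2 full) _.
  by rewrite leq_exp2l // !ltnS leq_add2l leq_mul2r orbT.
apply: all_covered_eventually => a b lt_a /hasP[n _ /andP[/eqP fn /eqP gn]].
have le_qy : (size q <= y n)%N.
  by have := f_le n (horizon c); have := x_le_y n; rewrite fn; lia.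
have [p [N [le_py Pp tail_lt]]] := light_program gapless Pq le_qy.
apply: (covered_eventually m_ge0 out_complete weight_le C_gt0 C_le Pp).
  by apply: leq_trans le_py _; rewrite -gn.
by apply: lt_le_trans tail_lt _; rewrite lee_fin ler_exp2V -fn.
Qed.

End BPGap.

Theorem theorem2 (R : realType)
    (D : seq bool -> option nat) (HD : optimal_decompressor D)
    (P : seq bool -> option nat) (HP : optimal_prefix_decompressor P)
    (m : nat -> R) (Hm : apriori_probability m)
    (x y : nat -> nat)
    (xy_distinct : injective (fun n => (x n, y n)))
    (x_le_y : forall n, (x n <= y n)%N)
    (x_lower : lower_semicomputable x)
    (y_upper : upper_semicomputable y)
    (xy_sum : (\sum_(0 <= n <oo) (2 ^ ((x n)%:Z - (y n)%:Z) : R)%:E = +oo)%E) :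
  (exists n b b' : nat,
      [/\ is_B D (x n) b, is_BP' m (y n) b' & (b' < b)%N]) /\
  (exists n b' b : nat,
      [/\ is_BP' m (x n) b', is_B P (y n) b & (b < b')%N]).
Proof.
have [f [f_comp f_le f_x]] := lower_semicomputableP x_lower.
have [g [g_comp g_ge g_y]] := upper_semicomputableP y_upper.
have unbounded := pair_mass_unbounded xy_distinct x_le_y f_x g_y
  (diverging_scaled_sums x_le_y xy_sum).
have [horizon horizon_comp horizon_rich] :=
  rich_horizon f_comp g_comp unbounded.
split.
- exact: (B_gt_BP' HD Hm.1 f_comp g_comp horizon_comp f_le g_ge horizon_rich).
- exact:
    (BP'_gt_BP HP Hm f_comp g_comp horizon_comp x_le_y f_le g_ge horizon_rich).
Qed.
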